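(* Let $\Sigma^{2}$ be an isometrically immersed surface in a homogeneous space $\mathbb{E}^{3}(\kappa,\tau)$. Then $$\square(2H)=\Delta K_{e}+|\nabla A|^{2}-4|\nabla H|^{2}+|\Phi|^{2}\big(2K_{e}+(\kappa-4\tau^{2})(5C^{2}-1)+2\tau^{2}\big)-2(\kappa-4\tau^{2})\big(H\langle\Phi(T),T\rangle+\tau\langle\Phi(T),J(T)\rangle\big).$$
   Context: Ambient space. For real numbers $\kappa,\tau$ with $\kappa\neq 4\tau^{2}$, $\mathbb{E}^{3}(\kappa,\tau)$ denotes the simply connected homogeneous Riemannian $3$-manifold with $4$-dimensional isometry group which is the total space of a Riemannian submersion $\pi:\mathbb{E}^{3}(\kappa,\tau)\to\mathbb{M}^{2}(\kappa)$ with constant bundle curvature $\tau$, where $\mathbb{M}^{2}(\kappa)$ is the simply connected surface of constant curvature $\kappa$; the fibers are geodesics and are the trajectories of a vertical unit Killing field $\xi$. The space is oriented, with vector product $\wedge$, so that $\overline{\nabla}_{X}\xi=\tau(X\wedge\xi)$, $\overline{\nabla}$ being the Levi-Civita connection. In local coordinates the metric is $\lambda^{2}(dx^{2}+dy^{2})+(dz+\tau\lambda(y\,dx-x\,dy))^{2}$ with $\lambda=(1+\frac{\kappa}{4}(x^{2}+y^{2}))^{-1}$, and $\xi=\partial_{z}$. Surfaces are smooth, connected, orientable, and oriented by a global unit normal $N$. $\nabla$ is the Levi-Civita connection and $\Delta$ the Laplacian ($\Delta u=\mathrm{tr}\,\mathrm{Hess}\,u$) of $\Sigma$; the shape operator is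 $A(X)=-\overline{\nabla}_{X}N$, $H=\frac12\mathrm{tr}(A)$, $K_{e}=\det(A)$ is the extrinsic curvature, $\Phi=A-HI$, $|\Phi|^{2}=\mathrm{tr}(\Phi^{2})$, $C=\langle N,\xi\rangle$, $T=\xi-CN$ is the tangential part of $\xi$, and $J(X)=N\wedge X$ is the rotation by $\pi/2$ on $T\Sigma$. $\nabla A(X,Y)=(\nabla_{Y}A)(X)$ and $|\nabla A|^{2}=\sum_{i,j}|\nabla A(e_{i},e_{j})|^{2}$ for an orthonormal frame $\{e_{1},e_{2}\}$. The Cheng-Yau operator is $\square u=\mathrm{tr}(P\circ\mathrm{Hess}\,u)$ for smooth $u:\Sigma\to\mathbb{R}$, where $P=2HI-A$. *)

(* Defs.v *)
From HB Require Import structures.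
From mathcomp Require Import all_boot all_order all_algebra.
From mathcomp Require Import all_classical all_reals all_analysis.

Set Implicit Arguments.
Unset Strict Implicit.
Unset Printing Implicit Defensive.

Import Order.TTheory GRing.Theory Num.Theory.
Import numFieldNormedType.Exports.

Local Open Scope classical_set_scope.
Local Open Scope ring_scope.

(* Points of R^n, coordinates of vectors and 1-forms are all row vectors.     *)

Definition partial (R : realType) (n : nat) (V : normedModType R)
    (i : 'I_n) (f : 'rV[R]_n -> V) (x : 'rV[R]_n) : V :=
  'D_(delta_mx 0 i) f x.

(* C^oo on U (meant for U open): all iterated partial derivatives exist and   *)
(* are continuous at each point of U; the values of f off U are irrelevant.   *)
Definition smooth_on (R : realType) (n : nat) (V : normedModType R)
    (U : set 'rV[R]_n) (f : 'rV[R]_n -> V) : Prop :=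
  forall (s : seq 'I_n) (x : 'rV[R]_n), U x ->
    {for x, continuous (foldr (@partial R n V) f s)} /\
    (forall i : 'I_n, derivable (foldr (@partial R n V) f s) x (delta_mx 0 i)).

(* Row i is the i-th partial derivative, so dF_x(v) = v *m jac F x.           *)
Definition jac (R : realType) (m n : nat) (F : 'rV[R]_m -> 'rV[R]_n)
    (x : 'rV[R]_m) : 'M[R]_(m, n) :=
  \matrix_(i < m) partial i F x.

(* The functions are total; only cmap on cdom and cinv on ccod are relevant.  *)
Record chart (R : realType) (n : nat) (T : topologicalType) := Chart {
  cdom : set T;
  cmap : T -> 'rV[R]_n;
  cinv : 'rV[R]_n -> T
}.

Definition ccod (R : realType) (n : nat) (T : topologicalType)
    (c : chart R n T) : set 'rV[R]_n := cmap c @` cdom c.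

Definition is_chart (R : realType) (n : nat) (T : topologicalType)
    (c : chart R n T) : Prop :=
  [/\ open (cdom c), open (ccod c),
      {within cdom c, continuous (cmap c)},
      {within ccod c, continuous (cinv c)} &
      forall p : T, cdom c p -> cinv c (cmap c p) = p].

(* Expression of f in the charts a (source) and b (target), and its domain.   *)
Definition locrep (R : realType) (m n : nat) (S T : topologicalType)
    (a : chart R m S) (b : chart R n T) (f : S -> T) : 'rV[R]_m -> 'rV[R]_n :=
  fun x => cmap b (f (cinv a x)).

Definition locdom (R : realType) (m n : nat) (S T : topologicalType)
    (a : chart R m S) (b : chart R n T) (f : S -> T) : set 'rV[R]_m :=
  cmap a @` (cdom a `&` f @^-1` cdom b).

Definition smooth_map (R : realType) (m n : nat) (S T : topologicalType)
    (A : set (chart R m S)) (B : set (chart R n T)) (f : S -> T) : Prop :=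
  continuous f /\
  (forall a b, A a -> B b -> smooth_on (locdom a b f) (locrep a b f)).

Definition smooth_manifold (R : realType) (n : nat) (T : topologicalType)
    (A : set (chart R n T)) : Prop :=
  [/\ hausdorff_space T, @second_countable T,
      (forall a, A a -> is_chart a),
      (forall p : T, exists2 a, A a & cdom a p) &
      (forall a b, A a -> A b -> smooth_on (locdom a b id) (locrep a b id))].

Definition simply_connected (R : realType) (T : topologicalType) : Prop :=
  (forall p q : T, exists c : R -> T,
     [/\ {within `[0, 1], continuous c}, c 0 = p & c 1 = q]) /\
  (forall c : R -> T, {within `[0, 1], continuous c} -> c 0 = c 1 ->
     exists h : R * R -> T,
     [/\ {within `[0, 1] `*` `[0, 1], continuous h},
         (forall t, 0 <= t <= 1 -> h (0, t) = c t /\ h (1, t) = c 0) &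
         (forall s, 0 <= s <= 1 -> h (s, 0) = c 0 /\ h (s, 1) = c 0)]).

Definition gdot (R : realType) (n : nat) (g : 'M[R]_n) (v w : 'rV[R]_n) : R :=
  (v *m g *m w^T) 0 0.

(* 1 / lambda *)
Definition ekt_conf (R : realType) (kappa : R) (x : 'rV[R]_3) : R :=
  1 + kappa / 4 * (x 0 0 ^+ 2 + x 0 1 ^+ 2).

Definition ekt_dom (R : realType) (kappa : R) : set 'rV[R]_3 :=
  [set x | 0 < ekt_conf kappa x].

Definition ekt_metric (R : realType) (kappa tau : R) (x : 'rV[R]_3) : 'M[R]_3 :=
  let lambda := (ekt_conf kappa x)^-1 in
  let dx : 'rV[R]_3 := delta_mx 0 0 in
  let dy : 'rV[R]_3 := delta_mx 0 1 in
  let dz : 'rV[R]_3 := delta_mx 0 2 in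
  let omega := dz + (tau * lambda) *: (x 0 1 *: dx - x 0 0 *: dy) in
  lambda ^+ 2 *: (dx^T *m dx + dy^T *m dy) + omega^T *m omega.

Definition ekt_xi (R : realType) : 'rV[R]_3 := delta_mx 0 2.

Definition metric_at (R : realType) (kappa tau : R) (F : 'rV[R]_3 -> 'rV[R]_3)
    (x : 'rV[R]_3) : Prop :=
  jac F x *m ekt_metric kappa tau (F x) *m (jac F x)^T =
  ekt_metric kappa tau x.

Definition ekt_isometry (R : realType) (kappa tau : R) (T : topologicalType)
    (A : set (chart R 3 T)) (F : T -> T) : Prop :=
  [/\ bijective F, smooth_map A A F &
      forall a b, A a -> A b -> forall x, locdom a b F x ->
        metric_at kappa tau (locrep a b F) x].

(* A simply connected, homogeneous, oriented Riemannian 3-manifold with a     *)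
(* distinguished vector field xi, given by an atlas in each chart of which    *)
(* the metric is ekt_metric, xi = d/dz, and (d/dx, d/dy, d/dz) is positive:   *)
(* the transition maps preserve the metric, xi and the orientation.  This     *)
(* orientation is the one for which nabla_X xi = tau (X /\ xi).  A single     *)
(* such chart does not cover the space when kappa > 0.                        *)
Record ekt_space (R : realType) (kappa tau : R) := EktSpace {
  ekt_carrier :> topologicalType;
  ekt_atlas : set (chart R 3 ekt_carrier);
  ekt_manifold : smooth_manifold ekt_atlas;
  ekt_cod : forall a, ekt_atlas a -> ccod a `<=` ekt_dom kappa;
  ekt_transition : forall a b, ekt_atlas a -> ekt_atlas b ->
    forall x, locdom a b id x ->
    [/\ metric_at kappa tau (locrep a b id) x,
        ekt_xi R *m jac (locrep a b id) x = ekt_xi R &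
        0 < \det (jac (locrep a b id) x)];
  ekt_simply_connected : simply_connected R ekt_carrier;
  ekt_homogeneous : forall p q : ekt_carrier,
    exists2 F, ekt_isometry kappa tau ekt_atlas F & F p = q
}.

(* snormal b p is the vector of components, in the chart b of the ambient     *)
(* space, of the unit normal at p.  The surface carries the induced metric.   *)
Record surface (R : realType) (kappa tau : R) (E : ekt_space kappa tau) :=
  Surface {
  scarrier :> topologicalType;
  satlas : set (chart R 2 scarrier);
  smanifold : smooth_manifold satlas;
  sconnected : connected [set: scarrier];
  simm : scarrier -> E;
  simm_smooth : smooth_map satlas (@ekt_atlas R kappa tau E) simm;
  simm_immersion : forall a b, satlas a -> ekt_atlas b ->
    forall u, locdom a b simm u -> \rank (jac (locrep a b simm) u) = 2%N;
  snormal : chart R 3 E -> scarrier -> 'rV[R]_3;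
  snormal_transition : forall b c, ekt_atlas b -> ekt_atlas c ->
    forall p, cdom b (simm p) -> cdom c (simm p) ->
    snormal c p = snormal b p *m jac (locrep b c id) (cmap b (simm p));
  snormal_smooth : forall a b, satlas a -> ekt_atlas b ->
    smooth_on (locdom a b simm) (fun u => snormal b (cinv a u));
  snormal_unit : forall b, ekt_atlas b -> forall p, cdom b (simm p) ->
    gdot (ekt_metric kappa tau (cmap b (simm p))) (snormal b p) (snormal b p) = 1;
  snormal_orthogonal : forall a b, satlas a -> ekt_atlas b ->
    forall u, locdom a b simm u -> forall i : 'I_2,
    gdot (ekt_metric kappa tau (locrep a b simm u))
        (snormal b (cinv a u)) (partial i (locrep a b simm) u) = 0
}.

(* Gamma^k_(ij) of the metric g *)
Definition christoffel (R : realType) (n : nat) (g : 'rV[R]_n -> 'M[R]_n)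
    (x : 'rV[R]_n) (k i j : 'I_n) : R :=
  2^-1 * \sum_(l < n) invmx (g x) k l *
    (partial i (fun y => g y j l) x + partial j (fun y => g y i l) x
     - partial l (fun y => g y i j) x).

Definition grad (R : realType) (n : nat) (g : 'rV[R]_n -> 'M[R]_n)
    (f : 'rV[R]_n -> R) (x : 'rV[R]_n) : 'rV[R]_n :=
  (\row_i partial i f x) *m invmx (g x).

(* An endomorphism of the tangent space is represented by the matrix B with   *)
(* B(d_j) = \sum_i B i j d_i.                                                 *)
Definition endo (R : realType) (n : nat) (B : 'M[R]_n) (v : 'rV[R]_n) :
    'rV[R]_n := v *m B^T.

(* The endomorphism X |-> nabla_X (grad f): the bilinear form                 *)
(* d_i d_j f - Gamma^k_(ij) d_k f with an index raised.                       *)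
Definition hess (R : realType) (n : nat) (g : 'rV[R]_n -> 'M[R]_n)
    (f : 'rV[R]_n -> R) (x : 'rV[R]_n) : 'M[R]_n :=
  invmx (g x) *m
  \matrix_(i, j) (partial i (partial j f) x
                  - \sum_(k < n) christoffel g x k i j * partial k f x).

Definition laplacian (R : realType) (n : nat) (g : 'rV[R]_n -> 'M[R]_n)
    (f : 'rV[R]_n -> R) (x : 'rV[R]_n) : R := \tr (hess g f x).

(* nabla_(d_k) B for a field of endomorphisms B *)
Definition nabla_endo (R : realType) (n : nat) (g : 'rV[R]_n -> 'M[R]_n)
    (B : 'rV[R]_n -> 'M[R]_n) (x : 'rV[R]_n) (k : 'I_n) : 'M[R]_n :=
  \matrix_(i, j) (partial k (fun y => B y i j) x
    + \sum_(l < n) christoffel g x i k l * B x l j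
    - \sum_(l < n) christoffel g x l k j * B x i l).

Definition orthonormal_frame (R : realType) (n : nat) (g : 'M[R]_n)
    (e : 'I_n -> 'rV[R]_n) : Prop :=
  forall i j, gdot g (e i) (e j) = (i == j)%:R.

(* Vector product for the metric g and the standard orientation of R^3:       *)
(* <v /\ w, z> is the Riemannian volume of (v, w, z).                         *)
Definition vprod (R : realType) (g : 'M[R]_3) (v w : 'rV[R]_3) : 'rV[R]_3 :=
  Num.sqrt (\det g) *:
  (\row_(l < 3) \det (\matrix_(i < 3) nth 0 [:: v; w; delta_mx 0 l] i))
  *m invmx g.

Section ParametrizedSurface.
Context (R : realType) (kappa tau : R).
Context (X N : 'rV[R]_2 -> 'rV[R]_3).
Implicit Types (u v : 'rV[R]_2) (w : 'rV[R]_3).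

Definition amb u : 'M[R]_3 := ekt_metric kappa tau (X u).

Definition first_form u : 'M[R]_2 :=
  \matrix_(i, j) gdot (amb u) (partial i X u) (partial j X u).

(* coordinates in the basis (d_0 X, d_1 X) of a vector w tangent at X u       *)
Definition tan_coord u w : 'rV[R]_2 :=
  (\row_k gdot (amb u) w (partial k X u)) *m invmx (first_form u).

(* covariant derivative in direction d_i X of a vector field W along X        *)
Definition cov_along (W : 'rV[R]_2 -> 'rV[R]_3) (i : 'I_2) u : 'rV[R]_3 :=
  partial i W u +
  \row_k \sum_l \sum_m christoffel (ekt_metric kappa tau) (X u) k l m *
                       (partial i X u) 0 l * (W u) 0 m.

Definition shape_op u : 'M[R]_2 :=
  \matrix_(i, j) tan_coord u (- cov_along N j u) 0 i.

Definition mean_curv u : R := 2^-1 * \tr (shape_op u).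

Definition ext_curv u : R := \det (shape_op u).

Definition Phi u : 'M[R]_2 := shape_op u - (mean_curv u)%:M.

Definition Phi_sq u : R := \tr (Phi u *m Phi u).

Definition angle_fun u : R := gdot (amb u) (N u) (ekt_xi R).

Definition xi_tan u : 'rV[R]_2 := tan_coord u (ekt_xi R - angle_fun u *: N u).

Definition rotJ u v : 'rV[R]_2 :=
  tan_coord u (vprod (amb u) (N u) (v *m jac X u)).

(* nabla A (v1, v2) = (nabla_v2 A) v1 *)
Definition nablaA u v1 v2 : 'rV[R]_2 :=
  endo (\sum_k v2 0 k *: nabla_endo first_form shape_op u k) v1.

Definition nablaA_sq u (e : 'I_2 -> 'rV[R]_2) : R :=
  \sum_i \sum_j gdot (first_form u) (nablaA u (e i) (e j)) (nablaA u (e i) (e j)).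

Definition cheng_yau (f : 'rV[R]_2 -> R) u : R :=
  \tr (((2 * mean_curv u)%:M - shape_op u) *m hess first_form f u).

Definition grad_sq (f : 'rV[R]_2 -> R) u : R :=
  gdot (first_form u) (grad first_form f u) (grad first_form f u).

End ParametrizedSurface.

(* Main.v *)
(* Let c = kappa - 4 tau^2, let A be the shape operator, B_k = nabla_k A and
   D_lk = nabla_l nabla_k A.  Since 2H = tr A and 2 K_e = (tr A)^2 - tr A^2,
   both Box(2H) and Lap K_e are linear in the D_lk up to terms quadratic in
   the B_k, and these quadratic terms cancel |nabla A|^2 - 4 |nabla H|^2 because
   the B_k are self-adjoint.  What remains is the Simons-type identity for
   <A, Lap A> - <A, Hess tr A>.  It follows from
     - the Codazzi equation
       (nabla_X A) Y - (nabla_Y A) X = c C (<Y,T> X - <X,T> Y),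
       differentiated once with nabla_X T = C (A X - tau J X) and
       grad C = - A T - tau J T;
     - the Ricci identity D_01 - D_10 = [R_01, A], the curvature being given
       by the Gauss equation K = K_e + tau^2 + c C^2;
     - |T|^2 = 1 - C^2.
   The Gauss and Codazzi equations are obtained at once from the equality of
   the mixed second derivatives of the moving frame (d_0 X, d_1 X, N),
   expressed in the orthonormal frame (E_0, E_1, xi) of the ambient space, in
   which the Levi-Civita connection is w |-> dw + o /\ w for an explicit o. *)

Require Import Defs.
From mathcomp Require Import all_boot all_order all_algebra.
From mathcomp Require Import all_classical all_reals all_analysis.
From mathcomp Require Import perm ring lra.
Import Order.TTheory GRing.Theory Num.Theory.
Import numFieldNormedType.Exports.
Local Open Scope classical_set_scope.
Local Open Scope ring_scope.

Set Implicit Arguments.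
Unset Strict Implicit.
Unset Printing Implicit Defensive.

(** * Smooth functions on an open set *)

(** Smoothness means existence and continuity of iterated partial derivatives, and no chain rule in
    several variables is used: the frame and its connection form are rational functions of the
    coordinates, so sums, products and inverses of functions along the surface suffice. The tangent
    frame is kept holonomic, so that commutation of mixed partial derivatives is the only
    integrability statement required; the price is a general Gram matrix g instead of the identity.
    At a point everything becomes an identity between rational functions of the entries of g, of the
    second fundamental form and of the components of xi. Self-adjoint endomorphisms are written as
    g^-1 times a symmetric matrix, which turns the symmetry conditions into free variables that
    [field] can handle. The charts of the surface may disagree with the orientation given by N.
    Hence J is expressed through the signed area s = <d_0 X /\ d_1 X, N>, with s^2 = det g, instead
    of the root of det g. In the pointwise identity s occurs only linearly, multiplied by tau, so
    its sign never has to be determined. *)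

Section SmoothCalculus.
Context (R : realType) (n : nat) (U : set 'rV[R]_n).
Hypothesis oU : open U.
Implicit Types (f g : 'rV[R]_n -> R) (x : 'rV[R]_n).

Lemma open_near_eq (V : normedModType R) (f g : 'rV[R]_n -> V) x :
  (forall y, U y -> f y = g y) -> U x -> \near x, f x = g x.
Proof.
move=> fg Ux; have : \near x, U x by apply: open_nbhs_nbhs; split.
by apply: filterS => y; exact: fg.
Qed.

Lemma partial_eq_on (V : normedModType R) (f g : 'rV[R]_n -> V) i x :
  (forall y, U y -> f y = g y) -> U x -> partial i f x = partial i g x.
Proof. by move=> fg Ux; apply: near_eq_derive; exact: open_near_eq. Qed.

Lemma smooth_on_continuous (V : normedModType R) (f : 'rV[R]_n -> V) x :
  smooth_on U f -> U x -> {for x, continuous f}.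
Proof. by move=> sf Ux; case: (sf [::] x Ux). Qed.

Lemma smooth_on_derivable (V : normedModType R) (f : 'rV[R]_n -> V) x i :
  smooth_on U f -> U x -> derivable f x (delta_mx 0 i).
Proof. by move=> sf Ux; case: (sf [::] x Ux). Qed.

Lemma smooth_on_partial (V : normedModType R) (f : 'rV[R]_n -> V) i :
  smooth_on U f -> smooth_on U (partial i f).
Proof.
(* [foldr] applies the last index first, so [rcons s i] differentiates along [i] before [s]. *)
move=> sf s x Ux; have := sf (rcons s i) x Ux.
by rewrite foldr_rcons.
Qed.

(** A direct induction for products or inverses would need a Leibniz rule of every order. Instead,
    this class has regular members and is stable under partial derivatives up to equality on [U];
    all orders follow at once. *)
Inductive smooth_closure : ('rV[R]_n -> R) -> Prop :=
| SmoothBase f : smooth_on U f -> smooth_closure f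
| SmoothCst c : smooth_closure (fun=> c)
| SmoothAdd f g : smooth_closure f -> smooth_closure g ->
    smooth_closure (fun x => f x + g x)
| SmoothMul f g : smooth_closure f -> smooth_closure g ->
    smooth_closure (fun x => f x * g x)
| SmoothInv f : (forall x, U x -> f x != 0) -> smooth_closure f ->
    smooth_closure (fun x => (f x)^-1).

Lemma smooth_closure_regular f x : smooth_closure f -> U x ->
  {for x, continuous f} /\ (forall i : 'I_n, derivable f x (delta_mx 0 i)).
Proof.
move=> sf Ux; elim: sf => {f}
  [f sf|c|f g _ [cf df] _ [cg dg]|f g _ [cf df] _ [cg dg]|f f0 _ [cf df]].
- exact: (sf [::] x Ux).
- split=> [|i]; first exact: cst_continuous.
  exact: derivable_cst.
- split=> [|i]; first exact: continuousD.
  exact: derivableD.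
- split=> [|i]; first exact: continuousM.
  exact: derivableM.
- split=> [|i]; first by apply: continuousV => //; exact: f0.
  by apply: derivableV => //; exact: f0.
Qed.

Lemma smooth_closure_partial f i : smooth_closure f ->
  exists2 g, smooth_closure g & forall x, U x -> partial i f x = g x.
Proof.
elim=> {f} [f sf|c|f g sf [f' sf' ff'] sg [g' sg' gg']
  |f g sf [f' sf' ff'] sg [g' sg' gg']|f f0 sf [f' sf' ff']].
- exists (partial i f) => //; apply: SmoothBase; exact: smooth_on_partial.
- exists (fun=> 0); first exact: SmoothCst.
  by move=> x _; exact: derive_cst.
- exists (fun x => f' x + g' x); first exact: SmoothAdd.
  move=> x Ux; rewrite -ff' // -gg' //.
  by apply: deriveD; apply: (smooth_closure_regular _ Ux).2.
- exists (fun x => f x * g' x + g x * f' x).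
    by apply: SmoothAdd; apply: SmoothMul.
  move=> x Ux; rewrite -ff' // -gg' //.
  by apply: deriveM; apply: (smooth_closure_regular _ Ux).2.
- exists (fun x => (f x)^-1 * (f x)^-1 * (-1 * f' x)).
    by apply: SmoothMul; apply: SmoothMul => //;
      [exact: SmoothInv|exact: SmoothInv|exact: SmoothCst].
  move=> x Ux; rewrite -ff' //.
  have := @deriveV _ _ f x (delta_mx 0 i) (f0 x Ux)
    ((smooth_closure_regular sf Ux).2 i).
  rewrite /partial => -> /=.
  by rewrite /GRing.scale /= expr2 invfM mulN1r mulrN mulNr.
Qed.

Lemma smooth_closure_smooth f : smooth_closure f -> smooth_on U f.
Proof.
move=> sf s; suff [g sg fg] : exists2 g, smooth_closure g &
    forall x, U x -> foldr (@partial R n R) f s x = g x.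
  move=> x Ux; have [cg dg] := smooth_closure_regular sg Ux.
  have gf : \near x, g x = foldr (@partial R n R) f s x.
    by apply: open_near_eq => // y Uy; rewrite fg.
  split=> [|i]; last exact: near_eq_derivable (dg i).
  move: cg; rewrite /prop_for /continuous_at fg // => cg.
  apply: (cvg_trans _ cg); exact: (near_eq_cvg gf).
elim: s => [|i s [g sg fg]]; first by exists f.
have [h sh gh] := smooth_closure_partial i sg.
by exists h => // x Ux; rewrite /= -gh //; exact: partial_eq_on.
Qed.

Lemma smooth_on_eq f g : (forall x, U x -> f x = g x) ->
  smooth_on U f -> smooth_on U g.
Proof.
move=> fg sf s.
have fgs x : U x -> foldr (@partial R n R) f s x = foldr (@partial R n R) g s x.
  elim: s x => [|i s ih] x Ux /=; first exact: fg.
  exact: partial_eq_on.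
move=> x Ux; have [cf df] := sf s x Ux.
have nfg := open_near_eq fgs Ux.
split=> [|i]; last exact: near_eq_derivable (df i).
move: cf; rewrite /prop_for /continuous_at fgs // => cf.
by apply: (cvg_trans _ cf); exact: (near_eq_cvg nfg).
Qed.

Lemma smooth_on_cst c : smooth_on U (fun=> c : R).
Proof. exact/smooth_closure_smooth/SmoothCst. Qed.

Lemma smooth_onD f g : smooth_on U f -> smooth_on U g ->
  smooth_on U (fun x => f x + g x).
Proof. by move=> *; apply/smooth_closure_smooth/SmoothAdd; exact: SmoothBase. Qed.

Lemma smooth_onM f g : smooth_on U f -> smooth_on U g ->
  smooth_on U (fun x => f x * g x).
Proof. by move=> *; apply/smooth_closure_smooth/SmoothMul; exact: SmoothBase. Qed.

Lemma smooth_onV f : (forall x, U x -> f x != 0) -> smooth_on U f ->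
  smooth_on U (fun x => (f x)^-1).
Proof. by move=> *; apply/smooth_closure_smooth/SmoothInv => //; exact: SmoothBase. Qed.

Lemma smooth_onN f : smooth_on U f -> smooth_on U (fun x => - f x).
Proof.
move=> sf; apply: (@smooth_on_eq (fun x => -1 * f x)).
  by move=> x _; rewrite mulN1r.
exact: (smooth_onM (smooth_on_cst (-1)) sf).
Qed.

Lemma smooth_onB f g : smooth_on U f -> smooth_on U g ->
  smooth_on U (fun x => f x - g x).
Proof. by move=> sf sg; exact: (smooth_onD sf (smooth_onN sg)). Qed.

Lemma smooth_onX f m : smooth_on U f -> smooth_on U (fun x => f x ^+ m).
Proof.
move=> sf; elim: m => [|m ih]; first exact: smooth_on_cst.
apply: (@smooth_on_eq (fun x => f x * f x ^+ m)).
  by move=> x _; rewrite exprS.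
exact: (smooth_onM sf ih).
Qed.

Lemma smooth_on_sum m (F : 'I_m -> 'rV[R]_n -> R) :
  (forall k, smooth_on U (F k)) -> smooth_on U (fun x => \sum_k F k x).
Proof.
move=> sF; elim: m F sF => [|m ih] F sF.
  apply: (@smooth_on_eq (fun=> 0)) (smooth_on_cst 0).
  by move=> x _; rewrite big_ord0.
apply: (@smooth_on_eq (fun x => F ord0 x + \sum_k F (lift ord0 k) x)).
  by move=> x _; rewrite big_ord_recl.
exact: (smooth_onD (sF ord0) (ih (fun k => F (lift ord0 k)) (fun k => sF _))).
Qed.

Lemma partialD f g i x : smooth_on U f -> smooth_on U g -> U x ->
  partial i (fun y => f y + g y) x = partial i f x + partial i g x.
Proof. by move=> sf sg Ux; apply: deriveD; exact: smooth_on_derivable. Qed.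

Lemma partialN f i x : smooth_on U f -> U x ->
  partial i (fun y => - f y) x = - partial i f x.
Proof. by move=> sf Ux; apply: deriveN; exact: smooth_on_derivable. Qed.

Lemma partialM f g i x : smooth_on U f -> smooth_on U g -> U x ->
  partial i (fun y => f y * g y) x = partial i f x * g x + f x * partial i g x.
Proof.
move=> sf sg Ux; rewrite addrC [partial i f x * _]mulrC.
have := @deriveM _ _ f g x (delta_mx 0 i) (smooth_on_derivable (i := i) sf Ux)
  (smooth_on_derivable (i := i) sg Ux).
by move=> e; rewrite /partial e.
Qed.

Lemma partial_cst (c : R) i x : partial i (fun=> c) x = 0.
Proof. exact: derive_cst. Qed.

Lemma partialV f i x : smooth_on U f -> U x -> f x != 0 ->
  partial i (fun y => (f y)^-1) x = - (partial i f x / f x ^+ 2).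
Proof.
move=> sf Ux f0; rewrite /partial.
have := @deriveV _ _ f x (delta_mx 0 i) f0 (smooth_on_derivable (i := i) sf Ux).
by move=> ->; rewrite /GRing.scale /= mulNr mulrC.
Qed.

Lemma partial_sum m (F : 'I_m -> 'rV[R]_n -> R) i x :
  (forall k, smooth_on U (F k)) -> U x ->
  partial i (fun y => \sum_k F k y) x = \sum_k partial i (F k) x.
Proof.
move=> sF Ux; elim: m F sF => [|m ih] F sF.
  rewrite big_ord0 -[RHS](partial_cst 0 i x).
  by congr (partial i _ x); apply/funext => y; rewrite big_ord0.
rewrite big_ord_recl -ih // -partialD //; last first.
  exact: (@smooth_on_sum _ (fun k => F (lift ord0 k))).
by congr (partial i _ x); apply/funext => y; rewrite big_ord_recl.
Qed.

End SmoothCalculus.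

(** * Symmetry of second derivatives *)

Section Coordinates.
Context (R : realType) (n : nat).

Lemma partial_coord (i j : 'I_n) (x : 'rV[R]_n) :
  partial i (fun y => y 0 j) x = (i == j)%:R.
Proof.
have := @derive_mx R 'rV[R]_n 1 n id x (delta_mx 0 i) (@derivable_id _ _ _ _).
rewrite derive_id => /matrixP /(_ 0 j); rewrite !mxE eqxx /= eq_sym => ->.
by [].
Qed.

Lemma smooth_on_coord (U : set 'rV[R]_n) (j : 'I_n) : open U ->
  smooth_on U (fun y : 'rV[R]_n => y 0 j).
Proof.
(* After the innermost derivation a coordinate is constant. *)
move=> oU; case/lastP => [|s i] x Ux.
  split=> [|i]; first exact: coord_continuous.
  have /derivable_mxP := @derivable_id R 'rV[R]_n x (delta_mx 0 i).
  exact.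
rewrite foldr_rcons.
have -> : partial i (fun y : 'rV[R]_n => y 0 j) = fun=> (i == j)%:R.
  by apply/funext => y; exact: partial_coord.
have sc := @smooth_on_cst _ n U oU (i == j)%:R s x Ux.
exact: sc.
Qed.

Lemma partial_entry p q (W : 'rV[R]_n -> 'M[R]_(p, q)) k x i j :
  (forall i j, derivable (fun y => W y i j) x (delta_mx 0 k)) ->
  partial k W x i j = partial k (fun y => W y i j) x.
Proof.
by move=> dW; rewrite {1}/partial derive_mx ?mxE //; apply/derivable_mxP.
Qed.

(** Passage from the vector-valued smoothness of the definitions to the entrywise smoothness in
    which the calculus below is done. *)
Lemma smooth_on_entry (U : set 'rV[R]_n) p q (W : 'rV[R]_n -> 'M[R]_(p.+1, q.+1)) i j :
  open U -> smooth_on U W -> smooth_on U (fun x => W x i j).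
Proof.
move=> oU sW s.
have entry x : U x -> foldr (@partial R n R) (fun x => W x i j) s x =
    foldr (@partial R n _) W s x i j.
  elim: s x => [|k s ih] x Ux //=.
  rewrite (partial_eq_on oU _ ih Ux); apply/esym/partial_entry.
  by apply/derivable_mxP; have [_] := sW s x Ux; apply.
move=> x Ux; have [cW dW] := sW s x Ux.
have nE : \near x, foldr (@partial R n _) W s x i j =
    foldr (@partial R n R) (fun x => W x i j) s x.
  by apply: (open_near_eq oU) => // y Uy; rewrite entry.
split=> [|k].
  have cWij : {for x, continuous (fun y => foldr (@partial R n _) W s y i j)}.
    apply: (continuous_comp (g := fun M : 'M[R]_(p.+1, q.+1) => M i j)) => //.
    exact: coord_continuous.
  move: cWij; rewrite /prop_for /continuous_at -entry // => cWij.
  by apply: (cvg_trans _ cWij); exact: (near_eq_cvg nE).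
apply: (near_eq_derivable nE).
by have /derivable_mxP := dW k; apply.
Qed.

End Coordinates.

Section Schwarz.
Context (R : realType) (n : nat).
Implicit Types (f : 'rV[R]_n -> R) (x v w : 'rV[R]_n).

(** The restriction of [f] to the segment has literally the same difference quotients as [f], so the
    one-variable mean value theorem applies without a chain rule. *)
Lemma partial_MVT f x (i : 'I_n) (t : R) : 0 < t ->
  (forall s, 0 <= s <= t -> derivable f (x + s *: delta_mx 0 i) (delta_mx 0 i)) ->
  exists2 c, 0 <= c <= t &
    f (x + t *: delta_mx 0 i) - f x = t * partial i f (x + c *: delta_mx 0 i).
Proof.
move=> t0 df; pose g s := f (x + s *: delta_mx 0 i).
pose dg s : R := partial i f (x + s *: delta_mx 0 i).
have eq_quot s : (fun h : R => h^-1 *: ((g \o shift s) (h *: 1) - g s)) =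
    (fun h => h^-1 *: ((f \o shift (x + s *: delta_mx 0 i))
      (h *: delta_mx 0 i) - f (x + s *: delta_mx 0 i))).
  apply/funext => h; rewrite /g /= /GRing.scale /= mulr1; congr (_ * (f _ - _)).
  by rewrite -/(GRing.scale _ _) scalerDl addrA [RHS]addrCA addrA.
have gd s : 0 <= s <= t -> is_derive s (1 : R) g (dg s).
  move=> st; split; first by rewrite /derivable eq_quot; exact: df.
  by rewrite /derive eq_quot.
have dgt s : s \in `]0, t[%R -> is_derive s (1 : R) g (dg s).
  by rewrite in_itv /= => /andP[s0 st]; apply: gd; rewrite !ltW.
have gc : {within `[0, t], continuous g}.
  apply: derivable_within_continuous => s; rewrite in_itv /= => st.
  by have [] := gd s st.
have [c] := MVT t0 dgt gc.
rewrite in_itv /= => /andP[c0 ct]; rewrite subr0 /g scale0r addr0 mulrC => e.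
by exists c; rewrite ?ltW.
Qed.

Lemma derive_quotient_shift f x v w :
  (fun h : R => h^-1 *: (((fun y => f (y + w)) \o shift x) (h *: v) - f (x + w))) =
  (fun h => h^-1 *: ((f \o shift (x + w)) (h *: v) - f (x + w))).
Proof. by apply/funext => h /=; rewrite addrA. Qed.

Lemma derivable_translate f x v w : derivable f (x + w) v ->
  derivable (fun y => f (y + w)) x v.
Proof. by rewrite /derivable derive_quotient_shift. Qed.

Lemma partial_translate f x w i :
  partial i (fun y => f (y + w)) x = partial i f (x + w).
Proof. by rewrite /partial /derive derive_quotient_shift. Qed.

(** Two mean values: one along [i] for the increment of [f] in direction [j], then one along [j] for
    [partial i f]. The left-hand side is symmetric in [i] and [j], which is what Schwarz's theorem
    exploits. *)
Lemma second_difference (U : set 'rV[R]_n) f x (i j : 'I_n) (t : R) :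
  smooth_on U f -> 0 < t ->
  (forall s r, 0 <= s <= t -> 0 <= r <= t ->
     U (x + s *: delta_mx 0 i + r *: delta_mx 0 j)) ->
  exists c d, [/\ 0 <= c <= t, 0 <= d <= t &
    f (x + t *: delta_mx 0 i + t *: delta_mx 0 j) - f (x + t *: delta_mx 0 i)
    - (f (x + t *: delta_mx 0 j) - f x) =
    t ^+ 2 * partial j (partial i f) (x + c *: delta_mx 0 i + d *: delta_mx 0 j)].
Proof.
move=> sf t0 inU.
have tt : 0 <= t <= t by rewrite lexx ltW.
have t00 : 0 <= (0 : R) <= t by rewrite lexx ltW.
have inU0 s : 0 <= s <= t -> U (x + s *: delta_mx 0 i).
  by move=> st; have := inU s 0 st t00; rewrite scale0r addr0.
pose phi y := f (y + t *: delta_mx 0 j) - f y.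
have dphi s : 0 <= s <= t ->
    derivable phi (x + s *: delta_mx 0 i) (delta_mx 0 i).
  move=> st; apply: derivableB; last by apply: smooth_on_derivable; [exact: sf|exact: inU0].
  apply: derivable_translate; apply: smooth_on_derivable; [exact: sf|exact: inU].
have [c ct] := partial_MVT t0 dphi.
have -> : partial i phi (x + c *: delta_mx 0 i) =
    partial i f (x + c *: delta_mx 0 i + t *: delta_mx 0 j) -
    partial i f (x + c *: delta_mx 0 i).
  rewrite -(partial_translate f (x + c *: delta_mx 0 i)); apply: deriveB.
    apply: derivable_translate; apply: smooth_on_derivable; [exact: sf|exact: inU].
  by apply: smooth_on_derivable; [exact: sf|exact: inU0].
have df s : 0 <= s <= t -> derivable (partial i f)
    (x + c *: delta_mx 0 i + s *: delta_mx 0 j) (delta_mx 0 j).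
  move=> st; apply: smooth_on_derivable; [exact: smooth_on_partial sf|exact: inU].
have [d dt ->] := partial_MVT t0 df.
rewrite /phi => e; exists c, d; split=> //.
by rewrite expr2 -mulrA -e.
Qed.

Lemma norm_delta_mx_le1 (i : 'I_n) : `|delta_mx 0 i : 'rV[R]_n| <= 1.
Proof.
rewrite /Num.Def.normr /= mx_normrE (bigmax_le _ ler01) //= => -[a b] _ /=.
by rewrite mxE; case: (_ && _); rewrite ?normr1 ?normr0.
Qed.

Local Opaque partial smooth_on.

Lemma partial_comm (U : set 'rV[R]_n) f x (i j : 'I_n) :
  open U -> smooth_on U f -> U x ->
  partial i (partial j f) x = partial j (partial i f) x.
Proof.
move=> oU sf Ux; apply/eqP; rewrite -subr_eq0 -normr_le0.
apply/ler_addgt0Pr => e e0; rewrite add0r.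
have nearG k l : \forall y \near x,
    `|partial k (partial l f) x - partial k (partial l f) y| < e / 2.
  have : {for x, continuous (partial k (partial l f))}.
    have sG : smooth_on U (partial k (partial l f)).
      by do 2 apply: smooth_on_partial.
    exact: (smooth_on_continuous sG Ux).
  by move=> /cvgrPdist_lt; apply; rewrite divr_gt0.
have nU : \forall y \near x, U y by apply: open_nbhs_nbhs; split.
have nG := filterI (nearG i j) (filterI (nearG j i) nU).
have [d /= d0 dP] := (nbhs_ballP _ _).1 (nG _ _).
(* Two displacements of length at most [t] stay inside the ball of radius [d]. *)
pose t := d / 3.
have t0 : 0 < t by rewrite divr_gt0.
have inball (k l : 'I_n) (s r : R) : 0 <= s <= t -> 0 <= r <= t ->
    ball x d (x + s *: delta_mx 0 k + r *: delta_mx 0 l).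
  move=> /andP[s0 st] /andP[r0 rt].
  rewrite -ball_normE /ball_ /= opprD opprD !addrA subrr sub0r -opprD normrN.
  rewrite (le_lt_trans (ler_normD _ _)) // !normrZ !ger0_norm //.
  have dk := norm_delta_mx_le1 k; have dl := norm_delta_mx_le1 l.
  have sk : s * `|delta_mx 0 k : 'rV[R]_n| <= t.
    by apply: le_trans st; rewrite ler_piMr.
  have rl : r * `|delta_mx 0 l : 'rV[R]_n| <= t.
    by apply: le_trans rt; rewrite ler_piMr.
  apply: le_lt_trans (lerD sk rl) _; rewrite /t; lra.
have inU (k l : 'I_n) (s r : R) : 0 <= s <= t -> 0 <= r <= t ->
    U (x + s *: delta_mx 0 k + r *: delta_mx 0 l).
  by move=> st rt; have [_ []] := dP _ (inball k l s r st rt).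
have [c [c' [ct ct' ec]]] := second_difference sf t0 (inU i j).
have [b [b' [bt bt' eb]]] := second_difference sf t0 (inU j i).
have e' : partial j (partial i f) (x + c *: delta_mx 0 i + c' *: delta_mx 0 j) =
    partial i (partial j f) (x + b *: delta_mx 0 j + b' *: delta_mx 0 i).
  apply: (@mulfI _ (t ^+ 2)); first by rewrite expf_neq0 // gt_eqF.
  apply: (etrans (esym ec)); apply: (etrans _ eb).
  rewrite [x + t *: delta_mx 0 j + _]addrAC.
  have swap (a1 a2 a3 a4 : R) : a1 - a2 - (a3 - a4) = a1 - a3 - (a2 - a4) by ring.
  exact: swap.
have [_ [h1 _]] := dP _ (inball i j c c' ct ct').
have [h2 _] := dP _ (inball j i b b' bt bt').
rewrite -(subrKA (partial i (partial j f) (x + b *: delta_mx 0 j + b' *: delta_mx 0 i))).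
apply: le_trans (ler_normD _ _) _; rewrite (splitr e); apply: lerD.
  exact: ltW h2.
by rewrite distrC -e'; exact: ltW h1.
Qed.

End Schwarz.

(** * Matrix-valued functions *)

(* Otherwise unification unfolds these two and does not terminate. *)
Local Opaque partial smooth_on.

Section MatrixCalculus.
Context (R : realType) (n : nat) (U : set 'rV[R]_n).
Hypothesis oU : open U.
Implicit Types (f g : 'rV[R]_n -> R) (x : 'rV[R]_n).

Definition smooth_mx p q (M : 'rV[R]_n -> 'M[R]_(p, q)) : Prop :=
  forall i j, smooth_on U (fun x => M x i j).

(** Entrywise, so that the matrix rules reduce to the scalar ones; [partial_row] compares it with
    the derivative in the normed space of rows. *)
Definition partial_mx p q i (M : 'rV[R]_n -> 'M[R]_(p, q)) x : 'M[R]_(p, q) :=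
  \matrix_(a, b) partial i (fun y => M y a b) x.

Lemma smooth_mx_eq p q (M N : 'rV[R]_n -> 'M[R]_(p, q)) :
  (forall x, U x -> M x = N x) -> smooth_mx M -> smooth_mx N.
Proof.
move=> MN sM i j; apply: (smooth_on_eq oU _ (sM i j)) => x Ux.
by rewrite MN.
Qed.

Lemma smooth_mxD p q (M N : 'rV[R]_n -> 'M[R]_(p, q)) :
  smooth_mx M -> smooth_mx N -> smooth_mx (fun x => M x + N x).
Proof.
move=> sM sN i j; apply: (smooth_on_eq oU _ (smooth_onD oU (sM i j) (sN i j))).
by move=> x _; rewrite mxE.
Qed.

Lemma smooth_mxN p q (M : 'rV[R]_n -> 'M[R]_(p, q)) :
  smooth_mx M -> smooth_mx (fun x => - M x).
Proof.
move=> sM i j; apply: (smooth_on_eq oU _ (smooth_onN oU (sM i j))).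
by move=> x _; rewrite mxE.
Qed.

Lemma smooth_mxB p q (M N : 'rV[R]_n -> 'M[R]_(p, q)) :
  smooth_mx M -> smooth_mx N -> smooth_mx (fun x => M x - N x).
Proof. by move=> sM sN; exact: (smooth_mxD sM (smooth_mxN sN)). Qed.

Lemma smooth_mxM p q r (M : 'rV[R]_n -> 'M[R]_(p, q)) (N : 'rV[R]_n -> 'M[R]_(q, r)) :
  smooth_mx M -> smooth_mx N -> smooth_mx (fun x => M x *m N x).
Proof.
move=> sM sN i j.
pose F k x := M x i k * N x k j.
have sF k : smooth_on U (F k) by exact: (smooth_onM oU (sM i k) (sN k j)).
by apply: (smooth_on_eq oU _ (smooth_on_sum oU sF)) => x _; rewrite mxE.
Qed.

Lemma smooth_mxZ p q f (M : 'rV[R]_n -> 'M[R]_(p, q)) :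
  smooth_on U f -> smooth_mx M -> smooth_mx (fun x => f x *: M x).
Proof.
move=> sf sM i j; apply: (smooth_on_eq oU _ (smooth_onM oU sf (sM i j))).
by move=> x _; rewrite mxE.
Qed.

Lemma smooth_mx_tr p q (M : 'rV[R]_n -> 'M[R]_(p, q)) :
  smooth_mx M -> smooth_mx (fun x => (M x)^T).
Proof.
move=> sM i j; apply: (smooth_on_eq oU _ (sM j i)).
by move=> x _; rewrite mxE.
Qed.

Lemma smooth_partial_mx p q i (M : 'rV[R]_n -> 'M[R]_(p, q)) :
  smooth_mx M -> smooth_mx (partial_mx i M).
Proof.
move=> sM a b.
have := @smooth_on_partial _ _ _ _ _ i (sM a b).
apply: (smooth_on_eq oU) => x _; by rewrite mxE.
Qed.

Lemma smooth_mxtrace p (M : 'rV[R]_n -> 'M[R]_p) :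
  smooth_mx M -> smooth_on U (fun x => \tr (M x)).
Proof. by move=> sM; apply: (smooth_on_sum oU (F := fun k x => M x k k)). Qed.

Lemma smooth_on_big_sum (I : Type) (r : seq I) (F : I -> 'rV[R]_n -> R) :
  (forall k, smooth_on U (F k)) -> smooth_on U (fun x => \sum_(k <- r) F k x).
Proof.
move=> sF; elim: r => [|a r ih].
  apply: (smooth_on_eq oU _ (smooth_on_cst oU 0)).
  by move=> x _; rewrite big_nil.
apply: (smooth_on_eq oU _ (smooth_onD oU (sF a) ih)).
by move=> x _; rewrite big_cons.
Qed.

Lemma smooth_on_big_prod (I : Type) (r : seq I) (F : I -> 'rV[R]_n -> R) :
  (forall k, smooth_on U (F k)) -> smooth_on U (fun x => \prod_(k <- r) F k x).
Proof.
move=> sF; elim: r => [|a r ih].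
  apply: (smooth_on_eq oU _ (smooth_on_cst oU 1)).
  by move=> x _; rewrite big_nil.
apply: (smooth_on_eq oU _ (smooth_onM oU (sF a) ih)).
by move=> x _; rewrite big_cons.
Qed.

Lemma smooth_det p (M : 'rV[R]_n -> 'M[R]_p) :
  smooth_mx M -> smooth_on U (fun x => \det (M x)).
Proof.
move=> sM.
apply: (@smooth_on_big_sum _ _ (fun (s : {perm 'I_p}) x => (-1) ^+ s * \prod_i M x i (s i))) => s.
apply: (smooth_onM oU (smooth_on_cst oU _)).
exact: (@smooth_on_big_prod _ _ (fun i x => M x i (s i))).
Qed.

(** Cramer's rule: the entries are cofactors divided by the determinant. *)
Lemma smooth_invmx p (M : 'rV[R]_n -> 'M[R]_p) :
  smooth_mx M -> (forall x, U x -> M x \in unitmx) ->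
  smooth_mx (fun x => invmx (M x)).
Proof.
move=> sM uM.
have sadj : smooth_mx (fun x => \adj (M x)).
  move=> i j; apply: (@smooth_on_eq _ _ _ oU
      (fun x => (-1) ^+ (j + i) * \det (row' j (col' i (M x))))).
    by move=> x _; rewrite mxE.
  apply: (smooth_onM oU (smooth_on_cst oU _)).
  apply: smooth_det => a b.
  by apply: (smooth_on_eq oU _ (sM (lift j a) (lift i b))) => x _; rewrite !mxE.
have sdet : smooth_on U (fun x => (\det (M x))^-1).
  apply: (smooth_onV oU) (smooth_det sM) => x Ux.
  by have := uM x Ux; rewrite unitmxE unitfE.
apply: (smooth_mx_eq _ (smooth_mxZ sdet sadj)) => x Ux.
by rewrite /invmx uM.
Qed.

Lemma partial_mx_eq p q i (M N : 'rV[R]_n -> 'M[R]_(p, q)) x :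
  (forall y, U y -> M y = N y) -> U x -> partial_mx i M x = partial_mx i N x.
Proof.
move=> MN Ux; apply/matrixP => a b; rewrite !mxE.
by apply: (partial_eq_on oU) => // y Uy; rewrite MN.
Qed.

Lemma partial_mx_cst p q i (C : 'M[R]_(p, q)) x : partial_mx i (fun=> C) x = 0.
Proof. by apply/matrixP => a b; rewrite !mxE partial_cst. Qed.

Lemma partial_mxD p q i (M N : 'rV[R]_n -> 'M[R]_(p, q)) x :
  smooth_mx M -> smooth_mx N -> U x ->
  partial_mx i (fun y => M y + N y) x = partial_mx i M x + partial_mx i N x.
Proof.
move=> sM sN Ux; apply/matrixP => a b; rewrite !mxE.
rewrite -(partialD _ (sM a b) (sN a b)) //.
by apply: (partial_eq_on oU) => // y _; rewrite mxE.
Qed.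

Lemma partial_mxN p q i (M : 'rV[R]_n -> 'M[R]_(p, q)) x :
  smooth_mx M -> U x -> partial_mx i (fun y => - M y) x = - partial_mx i M x.
Proof.
move=> sM Ux; apply/matrixP => a b; rewrite !mxE -(partialN _ (sM a b)) //.
by apply: (partial_eq_on oU) => // y _; rewrite mxE.
Qed.

Lemma partial_mxB p q i (M N : 'rV[R]_n -> 'M[R]_(p, q)) x :
  smooth_mx M -> smooth_mx N -> U x ->
  partial_mx i (fun y => M y - N y) x = partial_mx i M x - partial_mx i N x.
Proof.
move=> sM sN Ux.
by rewrite (partial_mxD _ sM (smooth_mxN sN) Ux) (partial_mxN _ sN Ux).
Qed.

Lemma partial_mxM p q r i (M : 'rV[R]_n -> 'M[R]_(p, q))
    (N : 'rV[R]_n -> 'M[R]_(q, r)) x :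
  smooth_mx M -> smooth_mx N -> U x ->
  partial_mx i (fun y => M y *m N y) x =
  partial_mx i M x *m N x + M x *m partial_mx i N x.
Proof.
move=> sM sN Ux; apply/matrixP => a b; rewrite !mxE.
pose F k y := M y a k * N y k b.
have sF k : smooth_on U (F k) by exact: (smooth_onM oU (sM a k) (sN k b)).
transitivity (partial i (fun y => \sum_k F k y) x).
  by apply: (partial_eq_on oU) => // y _; rewrite mxE.
rewrite (@partial_sum _ _ _ oU _ F) // -big_split; apply: eq_bigr => k _ /=.
by rewrite !mxE (partialM _ (sM a k) (sN k b)).
Qed.

Lemma partial_mx_tr p q i (M : 'rV[R]_n -> 'M[R]_(p, q)) x :
  partial_mx i (fun y => (M y)^T) x = (partial_mx i M x)^T.
Proof.
apply/matrixP => a b; rewrite !mxE; congr (partial i _ x).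
by apply/funext => y; rewrite mxE.
Qed.

Lemma partial_mxtrace p i (M : 'rV[R]_n -> 'M[R]_p) x :
  smooth_mx M -> U x ->
  partial i (fun y => \tr (M y)) x = \tr (partial_mx i M x).
Proof.
move=> sM Ux.
apply: (etrans (@partial_sum _ _ _ oU _ (fun k y => M y k k) i x
  (fun k => sM k k) Ux)).
by apply: eq_bigr => k _; rewrite mxE.
Qed.

Lemma partial_mx_comm p q i j (M : 'rV[R]_n -> 'M[R]_(p, q)) x :
  smooth_mx M -> U x ->
  partial_mx i (partial_mx j M) x = partial_mx j (partial_mx i M) x.
Proof.
move=> sM Ux; apply/matrixP => a b; rewrite [LHS]mxE [RHS]mxE.
transitivity (partial i (partial j (fun y => M y a b)) x).
  by apply: (partial_eq_on oU) => // y _; rewrite mxE.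
rewrite (partial_comm i j oU (sM a b) Ux).
by apply: (partial_eq_on oU) => // y _; rewrite mxE.
Qed.

End MatrixCalculus.

(** * The orthonormal frame of the ambient space *)

Lemma addmxE (V : nmodType) m n (A B : 'M[V]_(m, n)) i j :
  (A + B) i j = A i j + B i j.
Proof. by rewrite mxE. Qed.

Lemma oppmxE (V : zmodType) m n (A : 'M[V]_(m, n)) i j : (- A) i j = - A i j.
Proof. by rewrite mxE. Qed.

Lemma sum_ord2 (V : nmodType) (F : 'I_2 -> V) : \sum_i F i = F 0 + F 1.
Proof. by rewrite !big_ord_recl big_ord0 addr0; congr (F _ + F _); apply/val_inj. Qed.

Lemma sum_ord3 (V : nmodType) (F : 'I_3 -> V) : \sum_i F i = F 0 + F 1 + F 2.
Proof.
rewrite !big_ord_recl big_ord0 addr0 addrA.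
by congr (F _ + F _ + F _); apply/val_inj.
Qed.

Lemma ord2_ind (Q : 'I_2 -> Prop) : Q 0 -> Q 1 -> forall i, Q i.
Proof.
move=> Q0 Q1 [[|[|//]] h]; first by rewrite (_ : Ordinal h = 0) //; exact/val_inj.
by rewrite (_ : Ordinal h = 1) //; exact/val_inj.
Qed.

Lemma ord3_ind (Q : 'I_3 -> Prop) : Q 0 -> Q 1 -> Q 2 -> forall i, Q i.
Proof.
move=> Q0 Q1 Q2 [[|[|[|//]]] h].
- by rewrite (_ : Ordinal h = 0) //; exact/val_inj.
- by rewrite (_ : Ordinal h = 1) //; exact/val_inj.
- by rewrite (_ : Ordinal h = 2) //; exact/val_inj.
Qed.

Lemma ord3_eqE : ((0 == 1 :> 'I_3) = false) * ((0 == 2 :> 'I_3) = false) *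
  ((1 == 0 :> 'I_3) = false) * ((1 == 2 :> 'I_3) = false) *
  ((2 == 0 :> 'I_3) = false) * ((2 == 1 :> 'I_3) = false).
Proof. by []. Qed.

Lemma ord2_eqE : ((0 == 1 :> 'I_2) = false) * ((1 == 0 :> 'I_2) = false).
Proof. by []. Qed.

Lemma ord3_valE : ((0 : 'I_3) = 0%N :> nat) * ((1 : 'I_3) = 1%N :> nat) *
  ((2 : 'I_3) = 2%N :> nat).
Proof. by []. Qed.

Lemma ord3_liftE : (lift 0 0 = 1 :> 'I_3) * (lift 0 1 = 2 :> 'I_3) *
  (lift 1 0 = 0 :> 'I_3) * (lift 1 1 = 2 :> 'I_3) *
  (lift 2 0 = 0 :> 'I_3) * (lift 2 1 = 1 :> 'I_3).
Proof. by do !split; apply/val_inj. Qed.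

Lemma ord2_liftE : (lift 0 0 = 1 :> 'I_2) * (lift 1 0 = 0 :> 'I_2).
Proof. by do !split; apply/val_inj. Qed.

Lemma det_mx2 (R : comNzRingType) (A : 'M[R]_2) :
  \det A = A 0 0 * A 1 1 - A 0 1 * A 1 0.
Proof.
rewrite (expand_det_row _ 0) sum_ord2 /cofactor !det_mx11 !mxE /=.
by rewrite !ord2_liftE expr0 expr1 mul1r mulN1r mulrN.
Qed.

Lemma det_mx3 (R : comNzRingType) (A : 'M[R]_3) :
  \det A = A 0 0 * (A 1 1 * A 2 2 - A 1 2 * A 2 1)
          - A 0 1 * (A 1 0 * A 2 2 - A 1 2 * A 2 0)
          + A 0 2 * (A 1 0 * A 2 1 - A 1 1 * A 2 0).
Proof.
rewrite (expand_det_row _ 0) sum_ord3 /cofactor !det_mx2 !mxE !ord3_liftE.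
rewrite !ord3_valE expr0 expr1 sqrrN expr1n; ring.
Qed.

Definition mx3 (R : Type) (x0 : R) (s : seq (seq R)) : 'M[R]_3 :=
  \matrix_(i, j) nth x0 (nth [::] s i) j.

(** * Uniqueness of the Levi-Civita connection *)

Section LeviCivita.
Context (R : realType) (n : nat).

(** Koszul's formula, with [K i j l] standing for <nabla_i d_j, d_l>: the first hypothesis is
    compatibility with the metric, the second absence of torsion. It identifies the Christoffel
    symbols of both the ambient and the induced metric. *)
Lemma christoffel_unique (g : 'rV[R]_n -> 'M[R]_n) (K : 'I_n -> 'M[R]_n) x :
  (forall i j l, partial i (fun y => g y j l) x = K i j l + K i l j) ->
  (forall i j l, K i j l = K j i l) ->
  (g x)^T = g x ->
  forall i j k, christoffel g x k i j = (K i *m invmx (g x)) j k.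
Proof.
move=> dg symK symg i j k; rewrite /christoffel mxE mulr_sumr.
apply: eq_bigr => l _; rewrite !dg.
have -> : invmx (g x) k l = invmx (g x) l k.
  by rewrite -[in LHS]symg -trmx_inv mxE.
rewrite (symK j i l) (symK i l j) (symK j l i).
by field.
Qed.

Lemma christoffel_sym (g : 'rV[R]_n -> 'M[R]_n) x :
  (forall y, (g y)^T = g y) ->
  forall i j k, christoffel g x k i j = christoffel g x k j i.
Proof.
move=> symg i j k; rewrite /christoffel; congr (_ * _); apply: eq_bigr => l _.
congr (_ * _); rewrite [partial i _ _ + _]addrC; congr (_ - _).
by congr (partial l _ x); apply/funext => y; rewrite -[in LHS]symg mxE.
Qed.

End LeviCivita.

Section AmbientFrame.
Context (R : realType) (kappa tau : R).
Implicit Types (x w : 'rV[R]_3).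

(* Row m lists the components of d/dx_m in the orthonormal frame              *)
(* E_0 = d/dx / lambda - tau y d/dz, E_1 = d/dy / lambda + tau x d/dz,        *)
(* E_2 = xi, i.e. the columns are the dual coframe.                           *)
Definition frame x : 'M[R]_3 :=
  let lambda := (ekt_conf kappa x)^-1 in
  mx3 0 [:: [:: lambda; 0; tau * lambda * x 0 1];
            [:: 0; lambda; - (tau * lambda * x 0 0)];
            [:: 0; 0; 1]].

(** The [l]-th partial derivative of [frame] in closed form (see [partial_frame]); [dlambda] is the
    derivative of lambda. *)
Definition dframe (l : 'I_3) x : 'M[R]_3 :=
  let lambda := (ekt_conf kappa x)^-1 in
  let dlambda := - (kappa / 2 * lambda ^+ 2 *
                    ((l == 0)%:R * x 0 0 + (l == 1)%:R * x 0 1)) in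
  mx3 0 [:: [:: dlambda; 0; tau * (dlambda * x 0 1 + lambda * (l == 1)%:R)];
            [:: 0; dlambda; - (tau * (dlambda * x 0 0 + lambda * (l == 0)%:R))];
            [:: 0; 0; 0]].

(** Matrices act on rows: [w *m cross_mx a b c] is (a, b, c) /\ w. *)
Definition cross_mx (a b c : R) : 'M[R]_3 :=
  mx3 0 [:: [:: 0; c; - b]; [:: - c; 0; a]; [:: b; - a; 0]].

(* w' *m conn x w are the frame components of w' derived along w when the     *)
(* components of w' are constant: the connection form of the frame (E_i) is   *)
(* w' |-> o(w) /\ w' with o(w) the argument of cross_mx.                      *)
Definition conn x w : 'M[R]_3 :=
  cross_mx (tau * w 0 0) (tau * w 0 1)
    (- (tau * w 0 2) + kappa / 2 * (x 0 1 * w 0 0 - x 0 0 * w 0 1)).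

(** In an orthonormal frame this is compatibility of the connection with the metric. *)
Lemma conn_antisym x w : (conn x w)^T = - conn x w.
Proof.
apply/matrixP; elim/ord3_ind; elim/ord3_ind;
  by rewrite !mxE !ord3_valE /= ?oppr0 ?opprK.
Qed.

Lemma ekt_metricE x : ekt_metric kappa tau x = frame x *m (frame x)^T.
Proof.
apply/matrixP; elim/ord3_ind; elim/ord3_ind;
  rewrite /ekt_metric /frame /ekt_conf !mxE !sum_ord3 !mxE !big_ord1 !mxE !ord3_valE
   /= ?ord3_eqE ?eqxx /=; ring.
Qed.

(* The exterior derivative of the last coframe element is - tau times         *)
(* 2 lambda + (x d/dx + y d/dy) lambda = 2 lambda^2, whence the use of c0.     *)
Lemma frame_torsion x : ekt_conf kappa x != 0 -> forall l m a,
  (dframe l x + frame x *m conn x (row l (frame x))) m a =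
  (dframe m x + frame x *m conn x (row m (frame x))) l a.
Proof.
move=> c0.
(* Equality modulo the relation u = 1, here lambda times its inverse, with an explicit cofactor
   [k]. *)
have eqmod (k u a b : R) : u = 1 -> a - b = k * (u - 1) -> a = b.
  by move=> -> /eqP; rewrite subrr mulr0 subr_eq0 => /eqP.
have := mulVf c0; rewrite /frame /dframe /conn /ekt_conf.
move: (x 0 0) (x 0 1) => y z; move: (_^-1) => la hla.
elim/ord3_ind; elim/ord3_ind; elim/ord3_ind => //;
  rewrite !mxE !sum_ord3 !mxE ?ord3_eqE ?eqxx /= ?ord3_valE /=;
  by [field | apply: (eqmod (2 * tau * la)) hla _; field |
      apply: (eqmod (- (2 * tau * la))) hla _; field].
Qed.

Lemma det_frame x : \det (frame x) = (ekt_conf kappa x)^-1 ^+ 2.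
Proof. by rewrite det_mx3 !mxE !ord3_valE /=; move: (_^-1) => la; ring. Qed.

End AmbientFrame.

(** * Derivatives of the frame along a map *)

Section FrameDerivative.
Context (R : realType) (kappa tau : R) (n : nat) (U : set 'rV[R]_n).
Hypothesis oU : open U.
Context (Y : 'rV[R]_n -> 'rV[R]_3).
Hypothesis sY : smooth_mx U Y.
Hypothesis Y_dom : forall u, U u -> ekt_dom kappa (Y u).

Lemma ekt_dom_neq0 (x : 'rV[R]_3) : ekt_dom kappa x -> ekt_conf kappa x != 0.
Proof. by rewrite /ekt_dom /= => /lt0r_neq0. Qed.

Let lam u := (ekt_conf kappa (Y u))^-1.

Lemma smooth_conf : smooth_on U (fun u => ekt_conf kappa (Y u)).
Proof.
exact: (smooth_onD oU (smooth_on_cst oU 1) (smooth_onM oU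
  (smooth_on_cst oU (kappa / 4))
  (smooth_onD oU (smooth_onX oU 2 (sY 0 0)) (smooth_onX oU 2 (sY 0 1))))).
Qed.

Lemma smooth_lam : smooth_on U lam.
Proof.
by apply: (smooth_onV oU _ smooth_conf) => u Uu; exact/ekt_dom_neq0/Y_dom.
Qed.

Lemma partial_lam i u : U u -> partial i lam u =
  - (kappa / 2 * lam u ^+ 2 * (Y u 0 0 * partial i (fun v => Y v 0 0) u
                               + Y u 0 1 * partial i (fun v => Y v 0 1) u)).
Proof.
move=> Uu; rewrite (partialV _ smooth_conf Uu (ekt_dom_neq0 (Y_dom Uu))).
have sq j : partial i (fun v => Y v 0 j ^+ 2) u =
    2 * (Y u 0 j * partial i (fun v => Y v 0 j) u).
  have := partialM i (sY 0 j) (sY 0 j) Uu => e.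
  apply: (etrans e); move: (partial _ _ _) => d; ring.
have s2 j : smooth_on U (fun v => Y v 0 j ^+ 2) := smooth_onX oU 2 (sY 0 j).
have e1 := partialD i (smooth_on_cst oU 1) (smooth_onM oU
  (smooth_on_cst oU (kappa / 4)) (smooth_onD oU (s2 0) (s2 1))) Uu.
have e2 := partialM i (smooth_on_cst oU (kappa / 4)) (smooth_onD oU (s2 0) (s2 1)) Uu.
have e3 := partialD i (s2 0) (s2 1) Uu.
rewrite {1}/ekt_conf e1 e2 e3 !sq !partial_cst /lam.
move: (partial _ _ _) (partial _ _ _) (Y u 0 0) (Y u 0 1) => d0 d1 y0 y1.
by rewrite -exprVn; move: (ekt_conf _ _)^-1 => la; field.
Qed.

Lemma frame_entries (a b : 'I_3) u : frame kappa tau (Y u) a b =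
  nth 0 (nth [::] [:: [:: lam u; 0; tau * (lam u * Y u 0 1)];
                      [:: 0; lam u; - (tau * (lam u * Y u 0 0))];
                      [:: 0; 0; 1]] a) b.
Proof.
by rewrite mxE; elim/ord3_ind: a; elim/ord3_ind: b; rewrite !ord3_valE //= mulrA.
Qed.

Lemma smooth_frame : smooth_mx U (fun u => frame kappa tau (Y u)).
Proof.
move=> a b; apply: (smooth_on_eq oU (fun u _ => esym (frame_entries a b u))).
have sl j : smooth_on U (fun u => tau * (lam u * Y u 0 j)) :=
  smooth_onM oU (smooth_on_cst oU tau) (smooth_onM oU smooth_lam (sY 0 j)).
have s0 := smooth_on_cst oU 0; have s1 := smooth_on_cst oU 1.
elim/ord3_ind: a; elim/ord3_ind: b; rewrite !ord3_valE /=.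
- exact: smooth_lam.
- exact: s0.
- exact: (sl 1).
- exact: s0.
- exact: smooth_lam.
- exact: (smooth_onN oU (sl 0)).
- exact: s0.
- exact: s0.
- exact: s1.
Qed.

(** This replaces a chain rule: the entries of the frame are rational in [Y]. Taking [Y] to be the
    identity shows that [dframe] is the derivative of [frame]; taking the immersion differentiates
    the frame along the surface. *)
Lemma partial_frame i u : U u ->
  partial_mx i (fun v => frame kappa tau (Y v)) u =
  \sum_l partial i (fun v => Y v 0 l) u *: dframe kappa tau l (Y u).
Proof.
move=> Uu; apply/matrixP => a b; rewrite mxE summxE sum_ord3.
rewrite (partial_eq_on oU i (fun v _ => frame_entries a b v) Uu).
have sl j : smooth_on U (fun u => lam u * Y u 0 j) := smooth_onM oU smooth_lam (sY 0 j).
have dl j : partial i (fun v => tau * (lam v * Y v 0 j)) u =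
    tau * (partial i lam u * Y u 0 j + lam u * partial i (fun v => Y v 0 j) u).
  rewrite (partialM i (smooth_on_cst oU tau) (sl j) Uu) partial_cst mul0r add0r.
  by rewrite (partialM i smooth_lam (sY 0 j) Uu).
have dN j : partial i (fun v => - (tau * (lam v * Y v 0 j))) u =
    - (tau * (partial i lam u * Y u 0 j + lam u * partial i (fun v => Y v 0 j) u)).
  by rewrite -dl; exact: (partialN i (smooth_onM oU (smooth_on_cst oU tau) (sl j)) Uu).
elim/ord3_ind: a; elim/ord3_ind: b; rewrite !ord3_valE /= ?dl ?dN ?partial_cst
   ?(partial_lam i Uu) !mxE ?ord3_valE /= ?ord3_eqE ?eqxx /= /lam;
  repeat match goal with |- context [partial ?j ?f ?v] =>
    move: (partial j f v) => ? end;
  try move: (ekt_conf _ _)^-1 => ?; by field.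
Qed.

End FrameDerivative.

(** * The ambient connection in the orthonormal frame *)

Section AmbientConnection.
Context (R : realType) (kappa tau : R).
Implicit Types (x w : 'rV[R]_3).

Lemma ekt_dom_open : open (ekt_dom kappa).
Proof.
have sc : smooth_on setT (fun x : 'rV[R]_3 => ekt_conf kappa x).
  apply: (@smooth_conf R kappa 3 setT openT id) => i j.
  by rewrite (ord1 i); exact: (smooth_on_coord j openT).
have cc : continuous (fun x : 'rV[R]_3 => ekt_conf kappa x).
  by move=> x; exact: (smooth_on_continuous sc (x := x) I).
have -> : ekt_dom kappa = (fun x : 'rV[R]_3 => ekt_conf kappa x) @^-1` [set r | 0 < r].
  by [].
by apply: open_comp => [x _|]; [exact: cc|exact: open_gt].
Qed.

Lemma frame_unit x : ekt_dom kappa x -> frame kappa tau x \in unitmx.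
Proof.
move=> /ekt_dom_neq0 c0.
by rewrite unitmxE det_frame unitfE expf_neq0 // invr_eq0.
Qed.

(* Row m: components of the covariant derivative of d/dx_m along d/dx_l. *)
Definition frame_christoffel (l : 'I_3) x : 'M[R]_3 :=
  dframe kappa tau l x + frame kappa tau x *m conn kappa tau x (row l (frame kappa tau x)).

(** The connection defined by [conn] is metric, because [conn] is skew, and torsion-free by
    [frame_torsion]; by uniqueness it is the Levi-Civita connection. *)
Lemma christoffel_frame x l m a : ekt_dom kappa x ->
  \sum_k christoffel (ekt_metric kappa tau) x k l m * frame kappa tau x k a =
  frame_christoffel l x m a.
Proof.
move=> Dx; set th := frame kappa tau x.
have thU : th \in unitmx by exact: frame_unit.
have gE : ekt_metric kappa tau x = th *m th^T by exact: ekt_metricE.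
have G := @christoffel_unique R 3 (ekt_metric kappa tau)
  (fun l => frame_christoffel l x *m th^T) x.
have -> : \sum_k christoffel (ekt_metric kappa tau) x k l m * th k a =
    ((frame_christoffel l x *m th^T *m invmx (th *m th^T)) *m th) m a.
  rewrite mxE; apply: eq_bigr => k _; rewrite G -?gE //.
  - move=> i j p.
    have sth : smooth_mx (ekt_dom kappa) (frame kappa tau).
      apply: (@smooth_frame R kappa tau 3 _ ekt_dom_open id) => // i' j'.
      by rewrite (ord1 i'); exact: (smooth_on_coord j' ekt_dom_open).
    have dth : partial_mx i (frame kappa tau) x = dframe kappa tau i x.
      have := @partial_frame R kappa tau 3 _ ekt_dom_open id _ _ i x Dx.
      move=> /(_ _ _) ->; last by [].
        rewrite (bigD1 i) //= partial_coord eqxx scale1r big1 ?addr0 // => k' k'i.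
        by rewrite partial_coord eq_sym (negbTE k'i) scale0r.
      move=> i' j'; rewrite (ord1 i').
      exact: (smooth_on_coord j' ekt_dom_open).
    transitivity (partial_mx i (fun y => frame kappa tau y *m (frame kappa tau y)^T) x j p).
      rewrite mxE; congr (partial i _ x); apply/funext => y.
      by rewrite ekt_metricE.
    rewrite (partial_mxM ekt_dom_open i sth (smooth_mx_tr ekt_dom_open sth) Dx).
    rewrite (partial_mx_tr i (frame kappa tau)) dth -/th.
    (* The contribution of [Om] is skew and cancels when the transpose is added; what remains is the
       derivative of th th^T. *)
    rewrite /frame_christoffel !mulmxDl; set Om := conn _ _ _ _.
    have OmT : Om^T = - Om by exact: conn_antisym.
    have e : (th *m Om *m th^T)^T = - (th *m Om *m th^T).
      by rewrite !trmx_mul trmxK OmT mulNmx mulmxN mulmxA.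
    have ejp : (th *m Om *m th^T) p j = - (th *m Om *m th^T) j p.
      by move/matrixP: e => /(_ j p); rewrite [LHS]mxE [RHS]mxE.
    have ed : (th *m (dframe kappa tau i x)^T) j p = (dframe kappa tau i x *m th^T) p j.
      by rewrite -[in LHS](trmxK th) -trmx_mul mxE.
    by rewrite !addmxE ed ejp addrACA subrr addr0.
  - move=> i j p; rewrite mxE [RHS]mxE; apply: eq_bigr => b _.
    by rewrite /frame_christoffel (frame_torsion tau (ekt_dom_neq0 Dx) i j b).
  - by rewrite gE trmx_mul trmxK.
have -> : frame_christoffel l x *m th^T *m invmx (th *m th^T) *m th =
    frame_christoffel l x *m (th^T *m invmx (th *m th^T) *m th) by rewrite !mulmxA.
suff -> : th^T *m invmx (th *m th^T) *m th = 1%:M by rewrite mulmx1.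
apply: (can_inj (mulKmx thU)).
by rewrite !mulmxA mulmxV ?mul1mx ?mulmx1 // unitmx_mul unitmx_tr thU.
Qed.

Lemma conn_mulmx n x (v : 'rV[R]_n) (B : 'M[R]_(n, 3)) :
  conn kappa tau x (v *m B) = \sum_l v 0 l *: conn kappa tau x (row l B).
Proof.
have E w : conn kappa tau x w = w 0 0 *: conn kappa tau x (delta_mx 0 0)
    + w 0 1 *: conn kappa tau x (delta_mx 0 1)
    + w 0 2 *: conn kappa tau x (delta_mx 0 2).
  apply/matrixP; elim/ord3_ind; elim/ord3_ind;
  rewrite !mxE !ord3_valE /= ?mxE ?eqxx ?ord3_eqE /=; by ring.
rewrite E (eq_bigr _ (fun l _ => congr1 (GRing.scale (v 0 l)) (E (row l B)))).
rewrite !mxE !scaler_suml -!big_split /=; apply: eq_bigr => l _.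
by rewrite !mxE !scalerDr !scalerA.
Qed.

End AmbientConnection.

Section CovariantDerivative.
Context (R : realType) (kappa tau : R) (U : set 'rV[R]_2).
Hypothesis oU : open U.
Context (X W : 'rV[R]_2 -> 'rV[R]_3).
Hypothesis sX : smooth_mx U X.
Hypothesis sW : smooth_mx U W.
Hypothesis X_dom : forall u, U u -> ekt_dom kappa (X u).

Lemma partial_row i u : U u -> partial i W u = partial_mx i W u.
Proof.
move=> Uu; apply/rowP => a; rewrite partial_entry ?mxE // => b c.
exact: (smooth_on_derivable (sW b c) Uu).
Qed.

(** In frame components the ambient Christoffel symbols give way to one skew matrix, to which the
    structure equations below apply. *)
Lemma cov_along_frame i u : U u ->
  cov_along kappa tau X W i u *m frame kappa tau (X u) =
  partial_mx i (fun v => W v *m frame kappa tau (X v)) u +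
  W u *m frame kappa tau (X u) *m
    conn kappa tau (X u) (partial i X u *m frame kappa tau (X u)).
Proof.
move=> Uu; rewrite /cov_along mulmxDl (partial_row i Uu).
rewrite (partial_mxM oU i sW (smooth_frame tau oU sX X_dom) Uu) -addrA.
congr (_ + _); rewrite (partial_frame tau oU sX X_dom i Uu).
rewrite conn_mulmx -!mulmxA -mulmxDr mulmx_sumr -big_split /=.
have dX l : partial i X u 0 l = partial i (fun v => X v 0 l) u.
  by apply: partial_entry => b c; exact: (smooth_on_derivable (sX b c) Uu).
apply/rowP => a; rewrite [LHS]mxE [RHS]mxE.
under [LHS]eq_bigr => k _ do rewrite mxE mulr_suml.
rewrite [LHS]exchange_big.
transitivity (\sum_l partial i X u 0 l * \sum_m W u 0 m *
    frame_christoffel kappa tau l (X u) m a).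
  apply: eq_bigr => l _; rewrite mulr_sumr.
  under eq_bigr => k _ do rewrite mulr_suml.
  rewrite exchange_big; apply: eq_bigr => m _ /=.
  rewrite -(christoffel_frame tau l m a (X_dom Uu)) !mulr_sumr.
  by apply: eq_bigr => k _; ring.
under [RHS]eq_bigr => m _ do rewrite summxE mulr_sumr.
rewrite [RHS]exchange_big; apply: eq_bigr => l _ /=.
rewrite mulr_sumr; apply: eq_bigr => m _.
by rewrite dX -scalemxAr -scalerDr [in RHS]mxE /frame_christoffel; ring.
Qed.

End CovariantDerivative.

(** * Moving frames along a surface *)

Section GaussCodazziAlgebra.
Context (R : realFieldType).
Context (P : 'M[R]_(2, 3)) (N : 'rV[R]_3) (L0 L1 dL0 dL1 : 'M[R]_2).
Context (h0 h1 dh0 dh1 : 'cV[R]_2) (a0 a1 da0 da1 : 'rV[R]_2).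
Context (O0 O1 dO0 dO1 : 'M[R]_3).
Hypothesis PN : P *m N^T = 0.

Let NP : N *m P^T = 0.
Proof. by rewrite -[LHS]trmxK trmx_mul trmxK PN trmx0. Qed.

(** The hypothesis is the equality of the mixed derivatives of [P] after substitution of the
    structure equations; [dL1], [dh1], [dO1] are derivatives along index 0 and [dL0], [dh0], [dO0]
    along index 1. Multiplying by P^T removes the normal part, and the terms with a single factor
    [O0] or [O1] cancel in pairs. [codazzi_algebra] treats [N] in the same way. *)
Lemma gauss_algebra :
  dL1 *m P + L1 *m (L0 *m P + h0 *m N - P *m O0)
    + (dh1 *m N + h1 *m (- (a0 *m P) - N *m O0))
    - ((L0 *m P + h0 *m N - P *m O0) *m O1 + P *m dO1) =
  dL0 *m P + L0 *m (L1 *m P + h1 *m N - P *m O1)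
    + (dh0 *m N + h0 *m (- (a1 *m P) - N *m O1))
    - ((L1 *m P + h1 *m N - P *m O1) *m O0 + P *m dO0) ->
  (dL1 - dL0 + L1 *m L0 - L0 *m L1 - h1 *m a0 + h0 *m a1) *m (P *m P^T) =
  P *m (dO1 - dO0 - O0 *m O1 + O1 *m O0) *m P^T.
Proof.
move/(congr1 (mulmx^~ P^T)).
rewrite !(mulmxDl, mulmxDr, mulNmx, mulmxN) -!mulmxA NP !mulmx0 => /matrixP e.
apply/matrixP => i j; move: (e i j); rewrite !(addmxE, oppmxE) ![(0 : 'M[R]_2) i j]mxE.
lra.
Qed.

Lemma codazzi_algebra :
  - (da1 *m P + a1 *m (L0 *m P + h0 *m N - P *m O0))
    - ((- (a0 *m P) - N *m O0) *m O1 + N *m dO1) =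
  - (da0 *m P + a0 *m (L1 *m P + h1 *m N - P *m O1))
    - ((- (a1 *m P) - N *m O1) *m O0 + N *m dO0) ->
  (- (da1 - da0) - a1 *m L0 + a0 *m L1) *m (P *m P^T) =
  N *m (dO1 - dO0 - O0 *m O1 + O1 *m O0) *m P^T.
Proof.
move/(congr1 (mulmx^~ P^T)).
rewrite !(mulmxDl, mulmxDr, mulNmx, mulmxN) -!mulmxA NP !mulmx0 => /matrixP e.
apply/matrixP => i j; move: (e i j); rewrite !(addmxE, oppmxE) ![(0 : 'rV[R]_2) i j]mxE.
lra.
Qed.

End GaussCodazziAlgebra.

Section MovingFrame.
Context (R : realType) (U : set 'rV[R]_2).
Hypothesis oU : open U.
Context (P : 'rV[R]_2 -> 'M[R]_(2, 3)) (N : 'rV[R]_2 -> 'rV[R]_3)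
  (Om : 'I_2 -> 'rV[R]_2 -> 'M[R]_3).
Hypothesis sP : smooth_mx U P.
Hypothesis sN : smooth_mx U N.
Hypothesis sOm : forall i, smooth_mx U (Om i).
Hypothesis Om_antisym : forall i u, (Om i u)^T = - Om i u.

(** Row [j] holds the frame components of the ambient derivative of d_j X along d_i X. *)
Definition cov_tangent i u := partial_mx i P u + P u *m Om i u.
Definition cov_normal i u := partial_mx i N u + N u *m Om i u.
Definition gram u : 'M[R]_2 := P u *m (P u)^T.

Hypothesis torsion_free : forall u, U u ->
  forall i j a, cov_tangent i u j a = cov_tangent j u i a.
Hypothesis N_unit : forall u, U u -> N u *m (N u)^T = 1%:M.
Hypothesis N_orth : forall u, U u -> P u *m (N u)^T = 0.
Hypothesis gram_unit : forall u, U u -> gram u \in unitmx.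

(** Defined by the induced metric alone, so that it matches the intrinsic operators of the theorem;
    [conn_formE] shows that it is the tangential part of [cov_tangent]. The upper index is the
    column index, as suits matrices acting on rows. *)
Definition conn_form i u : 'M[R]_2 := \matrix_(j, k) christoffel gram u k i j.
Definition second_form i u : 'cV[R]_2 := cov_tangent i u *m (N u)^T.
Definition weingarten i u : 'rV[R]_2 :=
  - cov_normal i u *m (P u)^T *m invmx (gram u).

Let sPT : smooth_mx U (fun u => (P u)^T). Proof. exact: (smooth_mx_tr oU sP). Qed.
Let sNT : smooth_mx U (fun u => (N u)^T). Proof. exact: (smooth_mx_tr oU sN). Qed.

Lemma gram_sym u : (gram u)^T = gram u.
Proof. by rewrite /gram trmx_mul trmxK. Qed.

Lemma smooth_gram : smooth_mx U gram.
Proof. exact: (smooth_mxM oU sP sPT). Qed.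

Lemma smooth_cov_tangent i : smooth_mx U (cov_tangent i).
Proof.
exact: (smooth_mxD oU (smooth_partial_mx oU i sP) (smooth_mxM oU sP (sOm i))).
Qed.

Lemma smooth_cov_normal i : smooth_mx U (cov_normal i).
Proof.
exact: (smooth_mxD oU (smooth_partial_mx oU i sN) (smooth_mxM oU sN (sOm i))).
Qed.

Lemma smooth_second_form i : smooth_mx U (second_form i).
Proof. exact: (smooth_mxM oU (smooth_cov_tangent i) sNT). Qed.

Lemma smooth_weingarten i : smooth_mx U (weingarten i).
Proof.
apply: (smooth_mxM oU _ (smooth_invmx oU smooth_gram gram_unit)).
exact: (smooth_mxM oU (smooth_mxN oU (smooth_cov_normal i)) sPT).
Qed.

Lemma partial_gram i u : U u -> partial_mx i gram u =
  cov_tangent i u *m (P u)^T + (cov_tangent i u *m (P u)^T)^T.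
Proof.
move=> Uu; rewrite (partial_mxM oU i sP sPT Uu) (partial_mx_tr i P).
rewrite trmx_mul trmxK /cov_tangent mulmxDl [(_ + _)^T]raddfD /= mulmxDr.
by rewrite trmx_mul Om_antisym mulNmx mulmxN mulmxA addrACA subrr addr0.
Qed.

(** The tangential projection of the ambient connection is metric and torsion-free, hence it is the
    Levi-Civita connection of the Gram matrix. *)
Lemma conn_formE i u : U u ->
  conn_form i u = cov_tangent i u *m (P u)^T *m invmx (gram u).
Proof.
move=> Uu; apply/matrixP => j k; rewrite mxE.
apply: (christoffel_unique (K := fun i => cov_tangent i u *m (P u)^T)).
- move=> i' j' l; have /matrixP /(_ j' l) := partial_gram i' Uu.
  by rewrite [LHS]mxE => ->; rewrite [LHS]mxE [X in _ + X = _]mxE.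
- move=> i' j' l; rewrite mxE [RHS]mxE; apply: eq_bigr => a _.
  by rewrite (torsion_free Uu i' j' a).
- exact: gram_sym.
Qed.

Lemma smooth_conn_form i : smooth_mx U (conn_form i).
Proof.
apply: (smooth_mx_eq oU (fun u Uu => esym (conn_formE i Uu))).
apply: (smooth_mxM oU _ (smooth_invmx oU smooth_gram gram_unit)).
exact: (smooth_mxM oU (smooth_cov_tangent i) sPT).
Qed.

Lemma partial_gramE i u : U u ->
  partial_mx i gram u = conn_form i u *m gram u + gram u *m (conn_form i u)^T.
Proof.
move=> Uu; have gKT (B : 'M[R]_2) : gram u *m B^T = (B *m gram u)^T.
  by rewrite trmx_mul gram_sym.
by rewrite partial_gram // conn_formE // gKT mulmxKV ?gram_unit.
Qed.

(** The difference [V] of the two sides is orthogonal to the rows of [P] and to [N]. Stacked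
    together these form a square matrix, invertible because its Gram determinant is that of [P]; so
    [V] vanishes. *)
Lemma frame_decomposition m (W : 'M[R]_(m, 3)) u : U u ->
  W = W *m (P u)^T *m invmx (gram u) *m P u + W *m (N u)^T *m N u.
Proof.
move=> Uu; apply/eqP; rewrite -subr_eq0; apply/eqP; set V := _ - _.
have VP : V *m (P u)^T = 0.
  rewrite /V mulmxBl mulmxDl -!mulmxA -/(gram u) mulVmx ?gram_unit //.
  by rewrite -[N u *m _]trmxK trmx_mul trmxK N_orth // trmx0 !mulmx0 addr0 mulmx1 subrr.
have VN : V *m (N u)^T = 0.
  rewrite /V mulmxBl mulmxDl -!mulmxA N_orth // N_unit // !mulmx0 add0r.
  by rewrite mulmx1 subrr.
pose M := col_mx (P u) (N u).
have MM : M *m M^T = block_mx (gram u) 0 0 1%:M.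
  rewrite /M tr_col_mx mul_col_row N_unit // N_orth //.
  by rewrite -[N u *m _]trmxK trmx_mul trmxK N_orth // trmx0.
have VM : V *m M^T = 0 by rewrite /M tr_col_mx mul_mx_row VP VN row_mx0.
have : \det (M *m M^T) != 0.
  by rewrite MM det_ublock det1 mulr1 -unitfE -unitmxE gram_unit.
(* Retyping 2 + 1 rows as 3 makes the matrix square, so that the determinant of the product
   splits. *)
pose M3 : 'M[R]_3 := M.
have {}VM : V *m M3^T = 0 := VM.
rewrite -[X in X != 0]/(\det (M3 *m M3^T)) det_mulmx mulf_eq0 negb_or.
rewrite -!unitfE -!unitmxE => /andP[_ MU].
by rewrite -(mulmxK MU V) VM mul0mx.
Qed.

Lemma gauss_formula i u : U u ->
  cov_tangent i u = conn_form i u *m P u + second_form i u *m N u.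
Proof. by move=> Uu; rewrite conn_formE // -frame_decomposition. Qed.

Lemma cov_normal_tangent i u : U u -> cov_normal i u *m (N u)^T = 0.
Proof.
move=> Uu.
have d1 : partial_mx i (fun v => N v *m (N v)^T) u = 0.
  by rewrite (partial_mx_eq oU i N_unit Uu) partial_mx_cst.
have e : cov_normal i u *m (N u)^T + (cov_normal i u *m (N u)^T)^T = 0.
  rewrite -d1 (partial_mxM oU i sN sNT Uu) (partial_mx_tr i N).
  rewrite trmx_mul trmxK /cov_normal mulmxDl [(_ + _)^T]raddfD /= mulmxDr.
  by rewrite trmx_mul Om_antisym mulNmx mulmxN mulmxA addrACA subrr addr0.
apply/matrixP => p q; rewrite (ord1 p) (ord1 q) [RHS]mxE.
move/matrixP: e => /(_ 0 0); rewrite [LHS]mxE [X in _ + X]mxE [RHS]mxE.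
by move=> /eqP; rewrite -mulr2n mulrn_eq0 /= => /eqP.
Qed.

Lemma weingarten_formula i u : U u -> cov_normal i u = - weingarten i u *m P u.
Proof.
move=> Uu; rewrite {1}(frame_decomposition (cov_normal i u) Uu).
by rewrite cov_normal_tangent // mul0mx addr0 /weingarten !mulNmx opprK.
Qed.

(** Obtained by differentiating <d_j X, N> = 0. *)
Lemma second_formE i u : U u -> second_form i u = gram u *m (weingarten i u)^T.
Proof.
move=> Uu.
have d0 : partial_mx i (fun v => P v *m (N v)^T) u = 0.
  by rewrite (partial_mx_eq oU i N_orth Uu) partial_mx_cst.
have e : second_form i u + P u *m (cov_normal i u)^T = 0.
  rewrite -d0 (partial_mxM oU i sP sNT Uu) (partial_mx_tr i N).
  rewrite /second_form /cov_tangent /cov_normal mulmxDl [(_ + _)^T]raddfD /= mulmxDr.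
  by rewrite trmx_mul Om_antisym mulNmx mulmxN mulmxA addrACA subrr addr0.
move/eqP: e; rewrite addr_eq0 => /eqP ->.
by rewrite weingarten_formula // trmx_mul mulmxA -/(gram u) raddfN /= mulmxN opprK.
Qed.

Lemma second_form_sym i j u : U u -> second_form i u j 0 = second_form j u i 0.
Proof.
move=> Uu; rewrite mxE [RHS]mxE; apply: eq_bigr => a _.
by rewrite (torsion_free Uu i j a).
Qed.

Lemma partial_tangent i u : U u ->
  partial_mx i P u = conn_form i u *m P u + second_form i u *m N u - P u *m Om i u.
Proof. by move=> Uu; rewrite -gauss_formula // /cov_tangent addrK. Qed.

Lemma partial_normal i u : U u ->
  partial_mx i N u = - (weingarten i u *m P u) - N u *m Om i u.
Proof. by move=> Uu; rewrite -mulNmx -weingarten_formula // /cov_normal addrK. Qed.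

(** Commutator of the derivatives w |-> dw + w Om along d_0 and d_1. Since matrices act on rows, the
    products come in the order opposite to the usual one. *)
Definition ambient_curvature u : 'M[R]_3 :=
  partial_mx 0 (Om 1) u - partial_mx 1 (Om 0) u
  - Om 0 u *m Om 1 u + Om 1 u *m Om 0 u.

Lemma partial2_tangent i j u : U u -> partial_mx j (partial_mx i P) u =
  partial_mx j (conn_form i) u *m P u + conn_form i u *m partial_mx j P u
  + (partial_mx j (second_form i) u *m N u + second_form i u *m partial_mx j N u)
  - (partial_mx j P u *m Om i u + P u *m partial_mx j (Om i) u).
Proof.
move=> Uu; rewrite (partial_mx_eq oU j (partial_tangent i) Uu).
have s1 := smooth_mxM oU (smooth_conn_form i) sP.
have s2 := smooth_mxM oU (smooth_second_form i) sN.
have s3 := smooth_mxM oU sP (sOm i).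
rewrite (partial_mxB oU j (smooth_mxD oU s1 s2) s3 Uu) (partial_mxD oU j s1 s2 Uu).
rewrite (partial_mxM oU j (smooth_conn_form i) sP Uu).
rewrite (partial_mxM oU j (smooth_second_form i) sN Uu).
by rewrite (partial_mxM oU j sP (sOm i) Uu).
Qed.

Lemma partial2_normal i j u : U u -> partial_mx j (partial_mx i N) u =
  - (partial_mx j (weingarten i) u *m P u + weingarten i u *m partial_mx j P u)
  - (partial_mx j N u *m Om i u + N u *m partial_mx j (Om i) u).
Proof.
move=> Uu; rewrite (partial_mx_eq oU j (partial_normal i) Uu).
have s1 := smooth_mxM oU (smooth_weingarten i) sP.
have s3 := smooth_mxM oU sN (sOm i).
rewrite (partial_mxB oU j (smooth_mxN oU s1) s3 Uu) (partial_mxN oU j s1 Uu).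
rewrite (partial_mxM oU j (smooth_weingarten i) sP Uu).
by rewrite (partial_mxM oU j sN (sOm i) Uu).
Qed.

(** The first four terms are the intrinsic curvature, in the same row convention. *)
Lemma gauss_equation u : U u ->
  (partial_mx 0 (conn_form 1) u - partial_mx 1 (conn_form 0) u
   + conn_form 1 u *m conn_form 0 u - conn_form 0 u *m conn_form 1 u
   - second_form 1 u *m weingarten 0 u + second_form 0 u *m weingarten 1 u)
  *m gram u = P u *m ambient_curvature u *m (P u)^T.
Proof.
move=> Uu; have := partial_mx_comm oU 0 1 sP Uu.
rewrite (partial2_tangent 1 0 Uu) (partial2_tangent 0 1 Uu).
rewrite (partial_tangent 0 Uu) (partial_tangent 1 Uu).
rewrite (partial_normal 0 Uu) (partial_normal 1 Uu).
exact: gauss_algebra (N_orth Uu).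
Qed.

Lemma codazzi_equation u : U u ->
  (- (partial_mx 0 (weingarten 1) u - partial_mx 1 (weingarten 0) u)
   - weingarten 1 u *m conn_form 0 u + weingarten 0 u *m conn_form 1 u)
  *m gram u = N u *m ambient_curvature u *m (P u)^T.
Proof.
move=> Uu; have := partial_mx_comm oU 0 1 sN Uu.
rewrite (partial2_normal 1 0 Uu) (partial2_normal 0 1 Uu).
rewrite (partial_tangent 0 Uu) (partial_tangent 1 Uu).
rewrite (partial_normal 0 Uu) (partial_normal 1 Uu).
exact: codazzi_algebra (N_orth Uu).
Qed.

End MovingFrame.

(** * The pointwise Simons identity *)

Lemma invmx_mx2 (F : fieldType) (g : 'M[F]_2) : \det g != 0 ->
  [/\ invmx g 0 0 = g 1 1 / \det g, invmx g 0 1 = - (g 0 1 / \det g),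
      invmx g 1 0 = - (g 1 0 / \det g) & invmx g 1 1 = g 0 0 / \det g].
Proof.
move=> d0; have gU : g \in unitmx by rewrite unitmxE unitfE.
rewrite /invmx gU !mxE /cofactor !det_mx11 !mxE !ord2_liftE /= !expr0 !expr1 sqrrN expr1n.
by split; rewrite mulrC ?mul1r ?mulN1r ?mulNr.
Qed.

(** A self-adjoint matrix is g^-1 times a symmetric one; [a], [b], [c] are the entries of g M. They
    are free variables, so no side condition is left for [field]. *)
Lemma sym_mx2_param (F : fieldType) (g M : 'M[F]_2) :
  g 1 0 = g 0 1 -> \det g != 0 -> (g *m M)^T = g *m M ->
  exists a b c, [/\ M 0 0 = (g 1 1 * a - g 0 1 * b) / \det g,
                    M 0 1 = (g 1 1 * b - g 0 1 * c) / \det g,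
                    M 1 0 = (g 0 0 * b - g 0 1 * a) / \det g &
                    M 1 1 = (g 0 0 * c - g 0 1 * b) / \det g].
Proof.
move=> g10 d0 /matrixP /(_ 0 1); rewrite !mxE !sum_ord2 g10 => sM.
exists (g 0 0 * M 0 0 + g 0 1 * M 1 0), (g 0 1 * M 0 0 + g 1 1 * M 1 0),
  (g 0 1 * M 0 1 + g 1 1 * M 1 1).
move: d0; rewrite det_mx2 g10 => d0.
by split; [|rewrite sM| |rewrite sM]; field.
Qed.

Definition mx2 (R : Type) (a b c d : R) : 'M[R]_2 :=
  \matrix_(i, j) (if i == 0 then if j == 0 then a else b else if j == 0 then c else d).

(** Derivative of the determinant at [A] in direction [B], with [det_polar A A] equal to 2 det A. It
    also equals tr ((tr A - A) B), which links the Cheng-Yau operator to the Laplacian of the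
    determinant. *)
Definition det_polar (R : pzRingType) (A B : 'M[R]_2) : R :=
  A 0 0 * B 1 1 + A 1 1 * B 0 0 - A 0 1 * B 1 0 - A 1 0 * B 0 1.

Section SimonsAlgebra.
Context (R : realType) (g S : 'M[R]_2).
Hypothesis g_sym : g^T = g.
Hypothesis g_unit : \det g != 0.
Hypothesis gS_sym : (g *m S)^T = g *m S.

Let g10 : g 1 0 = g 0 1. Proof. by rewrite -[in LHS]g_sym mxE. Qed.

Lemma det_polarE (A B : 'M[R]_2) : det_polar A B = \tr A * \tr B - \tr (A *m B).
Proof. by rewrite /det_polar /mxtrace !sum_ord2 !mxE !sum_ord2; ring. Qed.

Let gU : g \in unitmx. Proof. by rewrite unitmxE unitfE. Qed.

(** The matrix E of the frame satisfies E g E^T = 1, whence E^T E = g^-1. The frame thus disappears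
    from |nabla A|^2. *)
Lemma orthonormal_frame_dual (e : 'I_2 -> 'rV[R]_2) : orthonormal_frame g e ->
  forall a b, \sum_i e i 0 a * e i 0 b = invmx g a b.
Proof.
move=> eo a b; pose E : 'M[R]_2 := \matrix_(i, c) e i 0 c.
have EgE : E *m (g *m E^T) = 1%:M.
  apply/matrixP => i j; rewrite [RHS]mxE -eo /gdot mulmxA mxE [RHS]mxE.
  by apply: eq_bigr => c _; rewrite !mxE; congr (_ * _); apply: eq_bigr => d _; rewrite !mxE.
have -> : invmx g = E^T *m E.
  by rewrite -[E^T](mulKmx gU) -mulmxA (mulmx1C EgE) mulmx1.
by rewrite mxE; apply: eq_bigr => i _; rewrite !mxE.
Qed.

Lemma orthonormal_frame_trace (e : 'I_2 -> 'rV[R]_2) (Q : 'M[R]_2) :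
  orthonormal_frame g e ->
  \sum_i (e i *m Q *m (e i)^T) 0 0 = \tr (Q *m invmx g).
Proof.
move=> eo; rewrite /mxtrace.
under [RHS]eq_bigr => a _ do rewrite mxE.
under [RHS]eq_bigr => a _ do under eq_bigr => b _ do
  rewrite -(orthonormal_frame_dual eo).
rewrite !sum_ord2 !mxE ?sum_ord2 ?mxE ?sum_ord2 ?mxE; ring.
Qed.

(** For self-adjoint B_k the squared norm is the sum of g^kl tr (B_k B_l). Adding the sum of g^kl
    det_polar (B_k, B_l) leaves that of g^kl tr B_k tr B_l, which is 4 |grad H|^2. *)
Lemma first_order_algebra (B : 'I_2 -> 'M[R]_2) (e : 'I_2 -> 'rV[R]_2) :
  (forall k, (g *m B k)^T = g *m B k) ->
  orthonormal_frame g e ->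
  \tr (invmx g *m \matrix_(l, k) det_polar (B l) (B k))
  + \sum_i \sum_j gdot g (endo (\sum_k e j 0 k *: B k) (e i))
                         (endo (\sum_k e j 0 k *: B k) (e i))
  = 4 * gdot g ((\row_k (2^-1 * \tr (B k))) *m invmx g)
               ((\row_k (2^-1 * \tr (B k))) *m invmx g).
Proof.
move=> sB eo; have dual := orthonormal_frame_dual eo.
pose Y k l := \tr (B k *m B l).
have gradE : gdot g ((\row_k (2^-1 * \tr (B k))) *m invmx g)
               ((\row_k (2^-1 * \tr (B k))) *m invmx g) =
    \sum_k \sum_l (2^-1 * \tr (B k)) * (2^-1 * \tr (B l)) * invmx g l k.
  rewrite /gdot mulmxKV // trmx_mul mxE; apply: eq_bigr => k _.
  rewrite [(\row_k _) 0 k]mxE mxE mulr_sumr; apply: eq_bigr => l _.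
  by rewrite !mxE; ring.
have nablaE : \sum_i \sum_j gdot g (endo (\sum_k e j 0 k *: B k) (e i))
                         (endo (\sum_k e j 0 k *: B k) (e i)) =
    \sum_k \sum_l invmx g k l * Y k l.
  rewrite exchange_big /=.
  transitivity (\sum_j \sum_k \sum_l e j 0 k * e j 0 l * Y k l).
    apply: eq_bigr => j _; pose M := \sum_k e j 0 k *: B k.
    transitivity (\sum_i (e i *m (M^T *m g *m M) *m (e i)^T) 0 0).
      by apply: eq_bigr => i _; rewrite /gdot /endo trmx_mul trmxK !mulmxA.
    rewrite (orthonormal_frame_trace _ eo).
    (* Self-adjointness turns the sum over [i] of the squared norms of M e_i into tr M^2. *)
    have -> : M^T *m g = g *m M.
      rewrite -[in LHS]g_sym -trmx_mul /M mulmx_sumr raddf_sum /=.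
      by apply: eq_bigr => k _; rewrite -scalemxAr linearZ /= sB.
    rewrite mxtrace_mulC !mulmxA mulVmx // mul1mx /M mulmx_suml raddf_sum /=.
    apply: eq_bigr => k _; rewrite mulmx_sumr raddf_sum /=.
    by apply: eq_bigr => l _; rewrite -scalemxAl -scalemxAr !mxtraceZ mulrA.
  rewrite exchange_big; apply: eq_bigr => k _ /=.
  rewrite exchange_big; apply: eq_bigr => l _ /=.
  by rewrite -mulr_suml dual.
have traceE : \tr (invmx g *m \matrix_(l, k) det_polar (B l) (B k)) =
    \sum_k \sum_l invmx g k l * (\tr (B k) * \tr (B l) - Y k l).
  rewrite /mxtrace; apply: eq_bigr => k _; rewrite mxE; apply: eq_bigr => l _.
  by rewrite mxE det_polarE mxtrace_mulC mulrC [\tr (B l) * _]mulrC mulrC.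
rewrite nablaE gradE traceE !sum_ord2.
move: (\tr (B 0)) (\tr (B 1)) (Y 0 0) (Y 0 1) (Y 1 0) (Y 1 1) => t0 t1 y0 y1 y2 y3.
move: (invmx g 0 0) (invmx g 0 1) (invmx g 1 0) (invmx g 1 1) => i0 i1 i2 i3.
by field.
Qed.

(** [T] holds the lowered components <xi, d_k X> and [u] the raised ones; [dC] and [dT] are the
    covariant derivatives of C and T, [Rm] is the matrix of R(d_0, d_1) and [s] the signed area. The
    four self-adjoint matrices [D l k] have twelve parameters; the differentiated Codazzi equation
    and the Ricci identity eliminate seven, and the other five cancel. *)
Lemma simons_algebra (kappa tau C s : R) (D : 'I_2 -> 'I_2 -> 'M[R]_2) (T : 'rV[R]_2) :
  let c := kappa - 4 * tau ^+ 2 in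
  let K := \det S + tau ^+ 2 + c * C ^+ 2 in
  let dC l := - (T *m S) 0 l
    + tau * s / \det g * (T 0 1 * g 0 l - T 0 0 * g 1 l) in
  let dT l j := (g *m S) j l * C
    - tau * s * C * (((l == 0) && (j == 1))%:R - ((l == 1) && (j == 0))%:R) in
  let Rm := mx2 (K * g 0 1) (K * g 1 1) (- (K * g 0 0)) (- (K * g 0 1)) in
  let u := T *m invmx g in
  let Phi := S - (2^-1 * \tr S)%:M in
  let PhiT := u *m Phi^T in
  (forall l k, (g *m D l k)^T = g *m D l k) ->
  (forall l, D l 0 0 1 - D l 1 0 0 = c * (dC l * T 0 1 + C * dT l 1)) ->
  (forall l, D l 0 1 1 - D l 1 1 0 = - (c * (dC l * T 0 0 + C * dT l 0))) ->
  D 0 1 - D 1 0 = Rm *m S - S *m Rm ->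
  (u *m T^T) 0 0 = 1 - C ^+ 2 ->
  \tr (((\tr S)%:M - S) *m (invmx g *m \matrix_(l, k) \tr (D l k)))
  - \tr (invmx g *m \matrix_(l, k) det_polar S (D l k)) =
  \tr (Phi *m Phi) * (2 * \det S + c * (5 * C ^+ 2 - 1) + 2 * tau ^+ 2)
  - 2 * c * (2^-1 * \tr S * (PhiT *m T^T) 0 0
             + tau * (s * (PhiT 0 1 * u 0 0 - PhiT 0 0 * u 0 1))).
Proof.
move=> c K dC dT Rm u Phi PhiT sD cod0 cod1 ric uT.
have [i00 i01 i10 i11] := invmx_mx2 g_unit.
have uE j : u 0 j = T 0 0 * invmx g 0 j + T 0 1 * invmx g 1 j by rewrite mxE sum_ord2.
have PE j : PhiT 0 j = u 0 0 * Phi j 0 + u 0 1 * Phi j 1.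
  by rewrite mxE sum_ord2 !mxE.
have trE (M : 'M[R]_2) : \tr M = M 0 0 + M 1 1 by rewrite /mxtrace sum_ord2.
have mulE m (M : 'M[R]_(m, 2)) n (M' : 'M[R]_(2, n)) i j :
    (M *m M') i j = M i 0 * M' 0 j + M i 1 * M' 1 j by rewrite mxE sum_ord2.
have subE m n (M M' : 'M[R]_(m, n)) i j : (M - M') i j = M i j - M' i j.
  by rewrite !mxE.
have Phi00 : Phi 0 0 = S 0 0 - 2^-1 * (S 0 0 + S 1 1).
  by rewrite subE trE mxE eqxx mulr1n.
have Phi11 : Phi 1 1 = S 1 1 - 2^-1 * (S 0 0 + S 1 1).
  by rewrite subE trE mxE eqxx mulr1n.
have Phi01 : Phi 0 1 = S 0 1 by rewrite subE mxE ord2_eqE mulr0n subr0.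
have Phi10 : Phi 1 0 = S 1 0 by rewrite subE mxE ord2_eqE mulr0n subr0.
(* Replacing 1 by |T|^2 + C^2 here uses up the relation between T and C; afterwards they are
   independent variables. *)
have {}uT : c * (5 * C ^+ 2 - 1) = c * (4 * C ^+ 2 - (u *m T^T) 0 0).
  by rewrite uT; ring.
clearbody PhiT; clearbody u Phi; rewrite uT {uT}.
rewrite ?(trE, mulE, subE) !mxE !PE !uE Phi00 Phi01 Phi10 Phi11 ?eqxx ?ord2_eqE ?mulr1n ?mulr0n /det_polar.
rewrite !trE i00 i01 i10 i11 {i00 i01 i10 i11 PE uE Phi00 Phi01 Phi10 Phi11}.
have [h00 [h01 [h11 [S00 S01 S10 S11]]]] := sym_mx2_param g10 g_unit gS_sym.
have [a00 [a01 [a11 [A00 A01 A10 A11]]]] := sym_mx2_param g10 g_unit (sD 0 0).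
have [b00 [b01 [b11 [B00 B01 B10 B11]]]] := sym_mx2_param g10 g_unit (sD 0 1).
have [k00 [k01 [k11 [K00 K01 K10 K11]]]] := sym_mx2_param g10 g_unit (sD 1 0).
have [m00 [m01 [m11 [M00 M01 M10 M11]]]] := sym_mx2_param g10 g_unit (sD 1 1).
have d0 : g 0 0 * g 1 1 - g 0 1 * g 0 1 != 0 by move: g_unit; rewrite det_mx2 g10.
have gE : \det g = g 0 0 * g 1 1 - g 0 1 * g 0 1 by rewrite det_mx2 g10.
(* Lowered by g, [cod0] and [cod1] compare entry (j, 1) of g D l 0 with entry (j, 0) of g D l 1, and
   [ric] compares [D 0 1] with [D 1 0]. The unknowns left are a00, k00, k01, k11 and m11. *)
have Ea01 : a01 = b00 + (g 0 0 * (D 0 0 0 1 - D 0 1 0 0) + g 0 1 * (D 0 0 1 1 - D 0 1 1 0)).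
  by rewrite A01 A11 B00 B10 gE; field.
have Ea11 : a11 = b01 + (g 0 1 * (D 0 0 0 1 - D 0 1 0 0) + g 1 1 * (D 0 0 1 1 - D 0 1 1 0)).
  by rewrite A01 A11 B00 B10 gE; field.
have Em00 : m00 = k01 - (g 0 0 * (D 1 0 0 1 - D 1 1 0 0) + g 0 1 * (D 1 0 1 1 - D 1 1 1 0)).
  by rewrite K01 K11 M00 M10 gE; field.
have Em01 : m01 = k11 - (g 0 1 * (D 1 0 0 1 - D 1 1 0 0) + g 1 1 * (D 1 0 1 1 - D 1 1 1 0)).
  by rewrite K01 K11 M00 M10 gE; field.
have ricE i j : D 0 1 i j - D 1 0 i j = (Rm *m S - S *m Rm) i j by rewrite -ric subE.
have Eb00 : b00 = k00 + (g 0 0 * (D 0 1 0 0 - D 1 0 0 0) + g 0 1 * (D 0 1 1 0 - D 1 0 1 0)).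
  by rewrite B00 B10 K00 K10 gE; field.
have Eb01 : b01 = k01 + (g 0 0 * (D 0 1 0 1 - D 1 0 0 1) + g 0 1 * (D 0 1 1 1 - D 1 0 1 1)).
  by rewrite B01 B11 K01 K11 gE; field.
have Eb11 : b11 = k11 + (g 0 1 * (D 0 1 0 1 - D 1 0 0 1) + g 1 1 * (D 0 1 1 1 - D 1 0 1 1)).
  by rewrite B01 B11 K01 K11 gE; field.
move: Ea01 Ea11 Em00 Em01 Eb00 Eb01 Eb11; rewrite !ricE !cod0 !cod1 /dC /dT /Rm /K /mx2.
rewrite A00 A01 A10 A11 B00 B01 B10 B11 K00 K01 K10 K11 M00 M01 M10 M11.
rewrite ?(mulE, subE) !mxE ?sum_ord2 ?eqxx ?ord2_eqE /= ?det_mx2 g10 S00 S01 S10 S11 gE /c.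
clear -d0; move: d0; move: (g 0 0) (g 0 1) (g 1 1) (T 0 0) (T 0 1) => g0 g1 g2 t0 t1 d0.
move=> -> -> -> -> -> -> ->.
by field.
Qed.
End SimonsAlgebra.

(** * Covariant derivatives of endomorphisms *)

Section CovariantEndomorphism.
Context (R : realType) (U : set 'rV[R]_2).
Hypothesis oU : open U.
Context (G : 'I_2 -> 'rV[R]_2 -> 'M[R]_2) (S : 'rV[R]_2 -> 'M[R]_2).
Hypothesis sG : forall k, smooth_mx U (G k).
Hypothesis sS : smooth_mx U S.
Hypothesis G_sym : forall k l m u, G k u m l = G l u m k.

Definition nabla k (B : 'rV[R]_2 -> 'M[R]_2) u : 'M[R]_2 :=
  partial_mx k B u + G k u *m B u - B u *m G k u.

(** The sum corrects for the differentiated index [k], making this the tensorial second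
    derivative. *)
Definition nabla2 l k u : 'M[R]_2 :=
  nabla l (nabla k S) u - \sum_m G l u m k *: nabla m S u.

Lemma smooth_nabla k B : smooth_mx U B -> smooth_mx U (nabla k B).
Proof.
move=> sB; apply: (smooth_mxB oU _ (smooth_mxM oU sB (sG k))).
exact: (smooth_mxD oU (smooth_partial_mx oU k sB) (smooth_mxM oU (sG k) sB)).
Qed.

(** Metricity of the connection writes g nabla_k B as the derivative of g B minus G^T (g B) + (g B)
    G; both are symmetric. *)
Lemma nabla_selfadjoint (g B : 'rV[R]_2 -> 'M[R]_2) k u :
  smooth_mx U g -> smooth_mx U B ->
  (forall v, U v -> partial_mx k g v = (G k v)^T *m g v + g v *m G k v) ->
  (forall v, U v -> (g v)^T = g v) ->
  (forall v, U v -> (g v *m B v)^T = g v *m B v) -> U u ->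
  (g u *m nabla k B u)^T = g u *m nabla k B u.
Proof.
move=> sg sB dg g_sym gB_sym Uu.
have dgB : partial_mx k (fun v => g v *m B v) u =
    (partial_mx k (fun v => g v *m B v) u)^T.
  rewrite -(partial_mx_tr k (fun v => g v *m B v)).
  exact: (partial_mx_eq oU k (fun v Uv => esym (gB_sym v Uv)) Uu).
have E : g u *m nabla k B u = partial_mx k (fun v => g v *m B v) u
    - ((G k u)^T *m (g u *m B u) + g u *m B u *m G k u).
  rewrite (partial_mxM oU k sg sB Uu) dg // /nabla mulmxDr mulmxDr mulmxN.
  rewrite mulmxDl !mulmxA opprD addrA; congr (_ - _).
  by rewrite [X in _ = X - _]addrC -addrA; congr (_ + _); rewrite addrC addKr.
rewrite E raddfB /= -dgB; congr (_ - _).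
by have := gB_sym u Uu; move: (g u *m B u) => H sH; rewrite raddfD /= !trmx_mul trmxK sH addrC.
Qed.

Lemma nabla2_selfadjoint (g : 'rV[R]_2 -> 'M[R]_2) l k u :
  smooth_mx U g ->
  (forall m v, U v -> partial_mx m g v = (G m v)^T *m g v + g v *m G m v) ->
  (forall v, U v -> (g v)^T = g v) ->
  (forall v, U v -> (g v *m S v)^T = g v *m S v) -> U u ->
  (g u *m nabla2 l k u)^T = g u *m nabla2 l k u.
Proof.
move=> sg dg g_sym gS_sym Uu.
have s1 m v : U v -> (g v *m nabla m S v)^T = g v *m nabla m S v.
  by move=> Uv; apply: nabla_selfadjoint => // w; exact: dg.
have s2 := nabla_selfadjoint sg (smooth_nabla k sS) (dg l) g_sym (s1 k) Uu.
rewrite /nabla2 mulmxBr raddfB /= s2; congr (_ - _).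
rewrite mulmx_sumr raddf_sum /=; apply: eq_bigr => m _.
by rewrite -scalemxAr linearZ /= s1.
Qed.

Lemma partial_nabla l k u : U u -> partial_mx l (nabla k S) u =
  partial_mx l (partial_mx k S) u
  + (partial_mx l (G k) u *m S u + G k u *m partial_mx l S u)
  - (partial_mx l S u *m G k u + S u *m partial_mx l (G k) u).
Proof.
move=> Uu; have s1 := smooth_partial_mx oU k sS.
have s2 := smooth_mxM oU (sG k) sS; have s3 := smooth_mxM oU sS (sG k).
rewrite (partial_mxB oU l (smooth_mxD oU s1 s2) s3 Uu) (partial_mxD oU l s1 s2 Uu).
by rewrite (partial_mxM oU l (sG k) sS Uu) (partial_mxM oU l sS (sG k) Uu).
Qed.

(** The corrections in [nabla2] cancel because the connection is torsion-free, the second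
    derivatives of [S] because they commute. *)
Lemma ricci_identity u : U u ->
  let Rm := partial_mx 0 (G 1) u - partial_mx 1 (G 0) u
            + G 0 u *m G 1 u - G 1 u *m G 0 u in
  nabla2 0 1 u - nabla2 1 0 u = Rm *m S u - S u *m Rm.
Proof.
move=> Uu Rm; rewrite /nabla2.
have -> : \sum_m G 1 u m 0 *: nabla m S u = \sum_m G 0 u m 1 *: nabla m S u.
  by apply: eq_bigr => m _; rewrite (G_sym 1 0).
rewrite opprB addrA subrK {1 3}/nabla.
rewrite (partial_nabla 0 1 Uu) (partial_nabla 1 0 Uu) (partial_mx_comm oU 0 1 sS Uu).
rewrite /nabla /Rm; move: (partial_mx 1 (partial_mx 0 S) u) (partial_mx 0 (G 1) u)
  (partial_mx 1 (G 0) u) (partial_mx 0 S u) (partial_mx 1 S u) (G 0 u) (G 1 u) (S u).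
move=> SS G01 G10 S0 S1 G0 G1 T {Rm}.
rewrite !(mulmxDl, mulmxDr, mulNmx, mulmxN) !mulmxA.
apply/matrixP => i j; rewrite !(addmxE, oppmxE).
ring.
Qed.

Let trE (A : 'M[R]_2) : \tr A = A 0 0 + A 1 1.
Proof. by rewrite /mxtrace sum_ord2. Qed.

Lemma trace_nabla k B u : \tr (nabla k B u) = \tr (partial_mx k B u).
Proof. by rewrite /nabla raddfB raddfD /= mxtrace_mulC addrK. Qed.

Lemma partial_trace k u : U u ->
  partial k (fun v => \tr (S v)) u = \tr (nabla k S u).
Proof. by move=> Uu; rewrite (partial_mxtrace oU k sS Uu) trace_nabla. Qed.

Lemma hessian_trace l k u : U u ->
  partial l (partial k (fun v => \tr (S v))) u
  - \sum_m G l u m k * partial m (fun v => \tr (S v)) u = \tr (nabla2 l k u).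
Proof.
move=> Uu; rewrite (partial_eq_on oU l (@partial_trace k) Uu).
rewrite (partial_mxtrace oU l (smooth_nabla k sS) Uu) /nabla2 raddfB /= trace_nabla.
congr (_ - _); rewrite raddf_sum /=; apply: eq_bigr => m _.
by rewrite mxtraceZ partial_trace.
Qed.

Lemma smooth_det_polar A B : smooth_mx U A -> smooth_mx U B ->
  smooth_on U (fun v => det_polar (A v) (B v)).
Proof.
move=> sA sB; pose s i j k l := smooth_onM oU (sA i j) (sB k l).
exact: (smooth_onB oU (smooth_onB oU (smooth_onD oU (s 0 0 1 1) (s 1 1 0 0))
  (s 0 1 1 0)) (s 1 0 0 1)).
Qed.

Lemma partial_det_polar l A B u : smooth_mx U A -> smooth_mx U B -> U u ->
  partial l (fun v => det_polar (A v) (B v)) u =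
  det_polar (partial_mx l A u) (B u) + det_polar (A u) (partial_mx l B u).
Proof.
move=> sA sB Uu; pose s i j k m := smooth_onM oU (sA i j) (sB k m).
have p i j k m := partialM l (sA i j) (sB k m) Uu.
have e1 := partialD l (smooth_onB oU (smooth_onD oU (s 0 0 1 1) (s 1 1 0 0))
  (s 0 1 1 0)) (smooth_onN oU (s 1 0 0 1)) Uu.
have e2 := partialD l (smooth_onD oU (s 0 0 1 1) (s 1 1 0 0))
  (smooth_onN oU (s 0 1 1 0)) Uu.
have e3 := partialD l (s 0 0 1 1) (s 1 1 0 0) Uu.
have e4 := partialN l (s 0 1 1 0) Uu.
have e5 := partialN l (s 1 0 0 1) Uu.
apply: (etrans e1); rewrite e5 p; rewrite e2 e4 p e3 !p /det_polar !mxE.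
ring.
Qed.

(** Infinitesimal invariance of the determinant under conjugation. It makes partial derivatives of
    [det_polar] obey the Leibniz rule for [nabla]. *)
Lemma det_polar_commutator (X A B : 'M[R]_2) :
  det_polar (X *m A - A *m X) B + det_polar A (X *m B - B *m X) = 0.
Proof. by rewrite /det_polar !mxE !sum_ord2; ring. Qed.

Lemma partial_det_polar_nabla l A B u : smooth_mx U A -> smooth_mx U B -> U u ->
  partial l (fun v => det_polar (A v) (B v)) u =
  det_polar (nabla l A u) (B u) + det_polar (A u) (nabla l B u).
Proof.
move=> sA sB Uu; rewrite partial_det_polar // /nabla -!addrA.
have := det_polar_commutator (G l u) (A u) (B u).
move: (G l u *m A u - A u *m G l u) (G l u *m B u - B u *m G l u).
move=> X Y; rewrite /det_polar !addmxE => e.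
apply/eqP; rewrite -subr_eq0 -oppr_eq0 -e; apply/eqP.
move: (partial_mx l A u) (partial_mx l B u) (A u) (B u) => A' B' A0 B0; ring.
Qed.

Lemma det_half_polar (A : 'M[R]_2) : \det A = 2^-1 * det_polar A A.
Proof. by rewrite det_mx2 /det_polar; field. Qed.

Lemma partial_det k u : U u ->
  partial k (fun v => \det (S v)) u = det_polar (S u) (nabla k S u).
Proof.
move=> Uu.
rewrite (partial_eq_on oU k (fun v _ => det_half_polar (S v)) Uu).
rewrite (partialM k (smooth_on_cst oU 2^-1) (smooth_det_polar sS sS) Uu).
rewrite partial_cst mul0r add0r partial_det_polar_nabla //.
by rewrite /det_polar; field.
Qed.

Lemma hessian_det l k u : U u ->
  partial l (partial k (fun v => \det (S v))) u
  - \sum_m G l u m k * partial m (fun v => \det (S v)) u =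
  det_polar (nabla l S u) (nabla k S u) + det_polar (S u) (nabla2 l k u).
Proof.
move=> Uu; rewrite (partial_eq_on oU l (@partial_det k) Uu).
rewrite (partial_det_polar_nabla l sS (smooth_nabla k sS) Uu) /nabla2 !sum_ord2.
rewrite !partial_det //; move: (nabla l (nabla k S) u) (nabla l S u) (nabla k S u)
  (nabla 0 S u) (nabla 1 S u) (S u) (G l u) => N B B' B0 B1 A H.
by rewrite /det_polar !mxE; ring.
Qed.

(** The column [v] is the value on (d_0, d_1) of a vector-valued 2-form; differentiating the two
    arguments produces the term with the trace of [G l]. *)
Lemma nabla_codazzi (v : 'rV[R]_2 -> 'cV[R]_2) l u :
  (forall w a, U w -> nabla 0 S w a 1 - nabla 1 S w a 0 = v w a 0) -> U u ->
  forall a, nabla2 l 0 u a 1 - nabla2 l 1 u a 0 =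
    partial_mx l v u a 0 + (G l u *m v u) a 0 - \tr (G l u) * v u a 0.
Proof.
move=> cod Uu a.
have dv : partial_mx l v u a 0 =
    partial_mx l (nabla 0 S) u a 1 - partial_mx l (nabla 1 S) u a 0.
  have s0 := smooth_nabla 0 sS a 1; have s1 := smooth_nabla 1 sS a 0.
  rewrite !mxE -(partialN l s1 Uu) -(partialD l s0 (smooth_onN oU s1) Uu).
  by apply: (partial_eq_on oU) => // w Uw; rewrite -cod.
have nablaE B : nabla l B u = partial_mx l B u + G l u *m B u - B u *m G l u by [].
rewrite dv /nabla2 !sum_ord2 (nablaE (nabla 0 S)) (nablaE (nabla 1 S)) trE.
have cod' b := cod u b Uu.
rewrite [X in _ = _ + X - _]mxE sum_ord2 -!cod'.
move: (nabla 0 S u) (nabla 1 S u) (partial_mx l _ _) (partial_mx l _ _) => B0 B1 P0 P1.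
rewrite !mxE !sum_ord2.
move: a {dv cod'}; elim/ord2_ind; ring.
Qed.

End CovariantEndomorphism.

(** * The cross product of the tangent frame *)

Definition row_cross (R : pzRingType) (p : 'M[R]_(2, 3)) : 'rV[R]_3 :=
  \row_a nth 0 [:: p 0 1 * p 1 2 - p 0 2 * p 1 1;
                   p 0 2 * p 1 0 - p 0 0 * p 1 2;
                   p 0 0 * p 1 1 - p 0 1 * p 1 0] a.

Section RowCross.
Context (R : realType) (p : 'M[R]_(2, 3)) (v : 'rV[R]_3).
Hypothesis v_unit : v *m v^T = 1%:M.
Hypothesis pv : p *m v^T = 0.

Local Notation q := (row_cross p).

(* Signed area of the parallelogram spanned by the rows of p, as seen from v. *)
Definition row_area : R := (q *m v^T) 0 0.

Local Notation s := row_area.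

Let v1 : v 0 0 * v 0 0 + v 0 1 * v 0 1 + v 0 2 * v 0 2 = 1.
Proof. by move/matrixP: v_unit => /(_ 0 0); rewrite !mxE sum_ord3 !mxE. Qed.

Let pv0 i : p i 0 * v 0 0 + p i 1 * v 0 1 + p i 2 * v 0 2 = 0.
Proof. by move/matrixP: pv => /(_ i 0); rewrite !mxE sum_ord3 !mxE. Qed.

Let sE : s = q 0 0 * v 0 0 + q 0 1 * v 0 1 + q 0 2 * v 0 2.
Proof. by rewrite /row_area mxE sum_ord3 !mxE. Qed.

(* q |v|^2 - <q, v> v = v /\ (q /\ v), and q /\ v = <p_0, v> p_1 - <p_1, v> p_0. *)
Lemma row_cross_parallel a : q 0 a = s * v 0 a.
Proof.
apply/eqP; rewrite -subr_eq0 sE; apply/eqP.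
have e0 := pv0 0; have e1 := pv0 1.
pose x b c := v 0 b * (p 1 c * (p 0 0 * v 0 0 + p 0 1 * v 0 1 + p 0 2 * v 0 2)
    - p 0 c * (p 1 0 * v 0 0 + p 1 1 * v 0 1 + p 1 2 * v 0 2)).
have x0 b c : x b c = 0 by rewrite /x e0 e1 !mulr0 subrr mulr0.
rewrite -[X in X - _]mulr1 -v1; elim/ord3_ind: a.
- by transitivity (x 1 2 - x 2 1); [rewrite /x !mxE !ord3_valE /=; ring|rewrite !x0 subrr].
- by transitivity (x 2 0 - x 0 2); [rewrite /x !mxE !ord3_valE /=; ring|rewrite !x0 subrr].
- by transitivity (x 0 1 - x 1 0); [rewrite /x !mxE !ord3_valE /=; ring|rewrite !x0 subrr].
Qed.

Lemma row_cross_sqr : q 0 0 * q 0 0 + q 0 1 * q 0 1 + q 0 2 * q 0 2 = s ^+ 2.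
Proof. by rewrite !row_cross_parallel -[RHS]mulr1 -v1; ring. Qed.

(** Lagrange's identity, q being [s] times a unit vector. *)
Lemma row_area_sqr : s ^+ 2 = \det (p *m p^T).
Proof. by rewrite -row_cross_sqr det_mx2 !mxE !sum_ord3 !mxE !ord3_valE /=; ring. Qed.

(** Last component of q /\ p_l = <p_0, p_l> p_1 - <p_1, p_l> p_0, where q = s v. *)
Lemma row_cross_xi l :
  p 1 2 * (p *m p^T) 0 l - p 0 2 * (p *m p^T) 1 l =
  s * (p l 1 * v 0 0 - p l 0 * v 0 1).
Proof.
transitivity (p l 1 * q 0 0 - p l 0 * q 0 1); last first.
  by rewrite !row_cross_parallel; ring.
by rewrite !mxE !sum_ord3 !mxE !ord3_valE /=; ring.
Qed.

Lemma row_area_cross l j : p l 0 * p j 1 - p l 1 * p j 0 =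
  (((l == 0) && (j == 1))%:R - ((l == 1) && (j == 0))%:R) * s * v 0 2.
Proof.
rewrite -mulrA -row_cross_parallel.
by elim/ord2_ind: l; elim/ord2_ind: j; rewrite !mxE !ord3_valE /=; ring.
Qed.

(** The triple product <v /\ p_l, p_k>, that is, the lowered matrix of the rotation J. *)
Lemma row_area_normal l k :
  (v 0 1 * p l 2 - v 0 2 * p l 1) * p k 0 + (v 0 2 * p l 0 - v 0 0 * p l 2) * p k 1
  + (v 0 0 * p l 1 - v 0 1 * p l 0) * p k 2 =
  s * (((l == 0) && (k == 1))%:R - ((l == 1) && (k == 0))%:R).
Proof.
by rewrite sE; elim/ord2_ind: l; elim/ord2_ind: k; rewrite !mxE !ord3_valE /=; ring.
Qed.

Context (tau c : R).

Let F := cross_mx (- (tau ^+ 2 * q 0 0)) (- (tau ^+ 2 * q 0 1))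
           (- (tau ^+ 2 * q 0 2) - c * q 0 2).

(** With f the axis of [F], the entry (0, 1) is <f /\ p_0, p_1> = <f, q>; then |q|^2 = s^2 and q = s
    v. *)
Lemma tangent_curvature : p *m F *m p^T =
  mx2 0 (- (\det (p *m p^T) * (tau ^+ 2 + c * v 0 2 ^+ 2)))
      (\det (p *m p^T) * (tau ^+ 2 + c * v 0 2 ^+ 2)) 0.
Proof.
have -> : \det (p *m p^T) * (tau ^+ 2 + c * v 0 2 ^+ 2) =
    tau ^+ 2 * (q 0 0 * q 0 0 + q 0 1 * q 0 1 + q 0 2 * q 0 2) + c * (q 0 2 * q 0 2).
  by rewrite row_cross_sqr -row_area_sqr !row_cross_parallel; ring.
apply/matrixP; elim/ord2_ind; elim/ord2_ind;
  rewrite !mxE !sum_ord3 !mxE !sum_ord3 !mxE !ord3_valE /=; ring.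
Qed.

(** The part of the axis of [F] along q is parallel to v and drops out; only the part along xi
    contributes. *)
Lemma normal_curvature l : (v *m F *m p^T) 0 l =
  - (c * v 0 2 * (p 1 2 * (p *m p^T) 0 l - p 0 2 * (p *m p^T) 1 l)).
Proof.
rewrite row_cross_xi /F !row_cross_parallel.
by rewrite !mxE !sum_ord3 !mxE !sum_ord3 !mxE !ord3_valE /=; ring.
Qed.

End RowCross.

(** * Moving frame of a surface in E(kappa, tau) *)

Section EktSurface.
Context (R : realType) (kappa tau : R) (U : set 'rV[R]_2).
Hypothesis oU : open U.
Context (X N : 'rV[R]_2 -> 'rV[R]_3).
Hypothesis sX : smooth_mx U X.
Hypothesis sN : smooth_mx U N.
Hypothesis X_dom : forall u, U u -> ekt_dom kappa (X u).
Hypothesis N_unit : forall u, U u -> gdot (amb kappa tau X u) (N u) (N u) = 1.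
Hypothesis N_orth : forall u, U u ->
  forall i, gdot (amb kappa tau X u) (N u) (partial i X u) = 0.
Hypothesis X_imm : forall u, U u -> \rank (jac X u) = 2%N.

Let th u := frame kappa tau (X u).

Definition frame_tangent u : 'M[R]_(2, 3) := jac X u *m th u.
Definition frame_normal u : 'rV[R]_3 := N u *m th u.
Definition frame_conn i u : 'M[R]_3 := conn kappa tau (X u) (row i (frame_tangent u)).

Local Notation P := frame_tangent.
Local Notation n := frame_normal.
Local Notation Om := frame_conn.

Lemma gdot_frame u v w :
  gdot (amb kappa tau X u) v w = ((v *m th u) *m (w *m th u)^T) 0 0.
Proof. by rewrite /gdot /amb ekt_metricE trmx_mul !mulmxA. Qed.

Lemma row_frame_tangent i u : row i (P u) = partial i X u *m th u.
Proof.
rewrite row_mul; congr (_ *m _); apply/rowP => j.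
by rewrite !mxE.
Qed.

Lemma first_form_gram : first_form kappa tau X = gram P.
Proof.
apply/funext => u; apply/matrixP => i j; rewrite mxE gdot_frame.
rewrite -(row_frame_tangent i) -(row_frame_tangent j) /gram mxE [RHS]mxE.
by apply: eq_bigr => a _; rewrite !mxE.
Qed.

Lemma smooth_th : smooth_mx U th.
Proof. exact: smooth_frame. Qed.

Lemma smooth_partial_X j : smooth_mx U (partial j X).
Proof.
apply: (smooth_mx_eq oU _ (smooth_partial_mx oU j sX)) => u Uu.
by rewrite (partial_row sX j Uu).
Qed.

Lemma smooth_jac : smooth_mx U (jac X).
Proof.
move=> i j; apply: (smooth_on_eq oU _ (smooth_partial_X i 0 j)) => u _.
by rewrite mxE.
Qed.

Lemma smooth_frame_tangent : smooth_mx U P.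
Proof. exact: (smooth_mxM oU smooth_jac smooth_th). Qed.

Lemma smooth_frame_normal : smooth_mx U n.
Proof. exact: (smooth_mxM oU sN smooth_th). Qed.

Lemma smooth_conn (w : 'rV[R]_2 -> 'rV[R]_3) : smooth_mx U w ->
  smooth_mx U (fun u => conn kappa tau (X u) (w u)).
Proof.
move=> sw.
pose o u := - (tau * w u 0 2) + kappa / 2 * (X u 0 1 * w u 0 0 - X u 0 0 * w u 0 1).
have s0 := smooth_on_cst oU 0.
have sm a : smooth_on U (fun u => tau * w u 0 a) :=
  smooth_onM oU (smooth_on_cst oU tau) (sw 0 a).
have so : smooth_on U o := smooth_onD oU (smooth_onN oU (sm 2))
  (smooth_onM oU (smooth_on_cst oU (kappa / 2))
     (smooth_onB oU (smooth_onM oU (sX 0 1) (sw 0 0)) (smooth_onM oU (sX 0 0) (sw 0 1)))).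
have E a b u : conn kappa tau (X u) (w u) a b = nth 0 (nth [::]
    [:: [:: 0; o u; - (tau * w u 0 1)]; [:: - o u; 0; tau * w u 0 0];
        [:: tau * w u 0 1; - (tau * w u 0 0); 0]] a) b by rewrite mxE.
move=> a b; apply: (smooth_on_eq oU (fun u _ => esym (E a b u))) => {E}.
elim/ord3_ind: a; elim/ord3_ind: b; rewrite !ord3_valE /=.
- exact: s0.
- exact: so.
- exact: (smooth_onN oU (sm 1)).
- exact: (smooth_onN oU so).
- exact: s0.
- exact: sm.
- exact: sm.
- exact: (smooth_onN oU (sm 0)).
- exact: s0.
Qed.

Lemma smooth_frame_conn i : smooth_mx U (Om i).
Proof.
apply: smooth_conn => a b.
by apply: (smooth_on_eq oU _ (smooth_frame_tangent i b)) => u _; rewrite [RHS]mxE.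
Qed.

Lemma frame_conn_antisym i u : (Om i u)^T = - Om i u.
Proof. exact: conn_antisym. Qed.

Lemma row_cov_tangent i j u : U u ->
  row j (cov_tangent P Om i u) = cov_along kappa tau X (partial j X) i u *m th u.
Proof.
move=> Uu; rewrite (cov_along_frame tau oU sX (smooth_partial_X j) X_dom i Uu).
rewrite /cov_tangent raddfD /=; congr (_ + _); last first.
  by rewrite row_mul row_frame_tangent /frame_conn row_frame_tangent.
apply/rowP => a; rewrite !mxE; congr (partial i _ u); apply/funext => v.
by rewrite -(row_frame_tangent j v) [RHS]mxE.
Qed.

Lemma cov_along_sym i j u : U u ->
  cov_along kappa tau X (partial j X) i u = cov_along kappa tau X (partial i X) j u.
Proof.
move=> Uu; apply: (f_equal2 +%R).
  rewrite (partial_row (smooth_partial_X j) i Uu) (partial_row (smooth_partial_X i) j Uu).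
  rewrite (partial_mx_eq oU i (fun v => partial_row sX j (u := v)) Uu).
  rewrite (partial_mx_eq oU j (fun v => partial_row sX i (u := v)) Uu).
  exact: (partial_mx_comm oU i j sX Uu).
have gsym y : (ekt_metric kappa tau y)^T = ekt_metric kappa tau y.
  by rewrite ekt_metricE trmx_mul trmxK.
move: (partial i X u) (partial j X u) => V W.
apply/rowP => k; rewrite [LHS]mxE [RHS]mxE exchange_big; apply: eq_bigr => l _.
apply: eq_bigr => m _; rewrite (christoffel_sym (X u) gsym m l k).
by rewrite mulrAC.
Qed.

Lemma frame_torsion_free u : U u -> forall i j a,
  cov_tangent P Om i u j a = cov_tangent P Om j u i a.
Proof.
move=> Uu i j a.
have e : row j (cov_tangent P Om i u) = row i (cov_tangent P Om j u).
  by rewrite (row_cov_tangent i j Uu) (row_cov_tangent j i Uu) (cov_along_sym i j Uu).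
by move/rowP: e => /(_ a); rewrite mxE [RHS]mxE.
Qed.

Lemma frame_normal_unit u : U u -> n u *m (n u)^T = 1%:M.
Proof.
move=> Uu; apply/matrixP => i j; rewrite (ord1 i) (ord1 j) -gdot_frame N_unit //.
by rewrite mxE.
Qed.

Lemma frame_normal_orth u : U u -> P u *m (n u)^T = 0.
Proof.
move=> Uu; rewrite -[LHS]trmxK trmx_mul trmxK; apply/matrixP => i j.
have := N_orth Uu i; rewrite gdot_frame -row_frame_tangent => e.
rewrite mxE [RHS]mxE -[RHS]e (ord1 j) !mxE.
by apply: eq_bigr => a _; rewrite !mxE.
Qed.

Lemma mulmx_tr_eq0 m (v : 'rV[R]_m) : v *m v^T = 0 -> v = 0.
Proof.
move=> /matrixP /(_ 0 0); rewrite mxE [RHS]mxE => e.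
apply/rowP => a; rewrite [RHS]mxE; apply/eqP; rewrite -sqrf_eq0; apply/eqP.
have s0 k : true -> 0 <= v 0 k * v^T k 0 by rewrite mxE -expr2 sqr_ge0.
by move/eqP: e; rewrite psumr_eq0 // => /allP /(_ a (mem_index_enum a)) /eqP;
  rewrite mxE expr2.
Qed.

(** If v g = 0 then |v P|^2 = 0, and the rows of [P] are independent since [jac X] has rank 2 and
    the frame is invertible. *)
Lemma frame_gram_unit u : U u -> gram P u \in unitmx.
Proof.
move=> Uu; rewrite -row_free_unit; apply: inj_row_free => v vg.
have Pfree : row_free (P u).
  rewrite /row_free /frame_tangent mxrankMfree ?X_imm //.
  by rewrite row_free_unit frame_unit //; exact: X_dom.
have : v *m P u = 0.
  by apply: mulmx_tr_eq0; rewrite trmx_mul mulmxA -(mulmxA v) vg mul0mx.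
by move=> vP; rewrite -[v]mulmx1 -(mulmxVp Pfree) mulmxA vP mul0mx.
Qed.

Lemma shape_opE u : U u ->
  shape_op kappa tau X N u = \matrix_(k, i) weingarten P n Om i u 0 k.
Proof.
move=> Uu; apply/matrixP => k i; rewrite /shape_op [LHS]mxE [RHS]mxE.
rewrite /tan_coord first_form_gram.
congr ((_ *m _) 0 k); apply/rowP => l; rewrite mxE gdot_frame.
rewrite mulNmx (cov_along_frame tau oU sX sN X_dom i Uu) -/(n u).
rewrite -(row_frame_tangent i u) -(row_frame_tangent l u) -/(Om i u).
rewrite [LHS]mxE [RHS]mxE; apply: eq_bigr => a _; congr (_ * _).
by rewrite [LHS]mxE [LHS]mxE [RHS]mxE.
Qed.

Let sP := smooth_frame_tangent.
Let sOm := smooth_frame_conn.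
Let anti := frame_conn_antisym.
Let tors := frame_torsion_free.

Local Notation wg := (weingarten P n Om).
Local Notation L := (conn_form P).
Local Notation c := (kappa - 4 * tau ^+ 2).

(** Differentiating [conn] brings in derivatives of X; this returns them to frame components. *)
Lemma partial_X_frame i u : U u ->
  (partial i (fun v => X v 0 0) u = P u i 0 * ekt_conf kappa (X u)) *
  (partial i (fun v => X v 0 1) u = P u i 1 * ekt_conf kappa (X u)).
Proof.
move=> Uu; have c0 := ekt_dom_neq0 (X_dom Uu).
have jacE a : jac X u i a = partial i (fun v => X v 0 a) u.
  by rewrite mxE (partial_row sX i Uu) mxE.
rewrite /frame_tangent !mxE !sum_ord3 -!jacE /th !mxE !ord3_valE /=.
by rewrite !mulr0 !addr0 add0r !(mulfVK c0).
Qed.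

(** The position enters [conn] only through the third component of its axis, and linearly; hence the
    extra [cross_mx] term. *)
Lemma partial_conn k (w : 'rV[R]_2 -> 'rV[R]_3) u : smooth_mx U w -> U u ->
  partial_mx k (fun v => conn kappa tau (X v) (w v)) u =
  conn kappa tau (X u) (partial_mx k w u) + cross_mx 0 0 (kappa / 2 *
    (partial k (fun v => X v 0 1) u * w u 0 0 - partial k (fun v => X v 0 0) u * w u 0 1)).
Proof.
move=> sw Uu.
pose o v := - (tau * w v 0 2) + kappa / 2 * (X v 0 1 * w v 0 0 - X v 0 0 * w v 0 1).
have sm a : smooth_on U (fun v => tau * w v 0 a) :=
  smooth_onM oU (smooth_on_cst oU tau) (sw 0 a).
have sy a b : smooth_on U (fun v => X v 0 a * w v 0 b) := smooth_onM oU (sX 0 a) (sw 0 b).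
have so1 := smooth_onB oU (sy 1 0) (sy 0 1).
have so2 := smooth_onM oU (smooth_on_cst oU (kappa / 2)) so1.
have so : smooth_on U o := smooth_onD oU (smooth_onN oU (sm 2)) so2.
have E a b v : conn kappa tau (X v) (w v) a b = nth 0 (nth [::]
    [:: [:: 0; o v; - (tau * w v 0 1)]; [:: - o v; 0; tau * w v 0 0];
        [:: tau * w v 0 1; - (tau * w v 0 0); 0]] a) b by rewrite mxE.
have dm a : partial k (fun v => tau * w v 0 a) u = tau * partial k (fun v => w v 0 a) u.
  by rewrite (partialM k (smooth_on_cst oU tau) (sw 0 a) Uu) partial_cst mul0r add0r.
have dNm a : partial k (fun v => - (tau * w v 0 a)) u = - (tau * partial k (fun v => w v 0 a) u).
  by rewrite (partialN k (sm a) Uu) dm.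
have dy a b := partialM k (sX 0 a) (sw 0 b) Uu.
have do_ : partial k o u = - (tau * partial k (fun v => w v 0 2) u) + kappa / 2 *
    (partial k (fun v => X v 0 1) u * w u 0 0 + X u 0 1 * partial k (fun v => w v 0 0) u
     - (partial k (fun v => X v 0 0) u * w u 0 1 + X u 0 0 * partial k (fun v => w v 0 1) u)).
  have e1 := partialD k (smooth_onN oU (sm 2)) so2 Uu.
  have e2 := partialM k (smooth_on_cst oU (kappa / 2)) so1 Uu.
  have e3 := partialD k (sy 1 0) (smooth_onN oU (sy 0 1)) Uu.
  have e4 := partialN k (sy 0 1) Uu.
  apply: (etrans e1); rewrite e2 partial_cst mul0r add0r e3 e4 !dy.
  by rewrite (partialN k (sm 2) Uu) dm.
have dNo : partial k (fun v => - o v) u = - partial k o u := partialN k so Uu.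
apply/matrixP => a b; rewrite [LHS]mxE addmxE.
rewrite (partial_eq_on oU k (fun v _ => E a b v) Uu).
clear E dy so1 so2; elim/ord3_ind: a; elim/ord3_ind: b;
  rewrite !ord3_valE /= ?dNo ?do_ ?dm ?dNm ?partial_cst !mxE !ord3_valE /= ?mxE;
  repeat match goal with |- context [partial ?j ?f ?v] =>
    move: (partial j f v) => ? end; ring.
Qed.

Local Notation q u := (row_cross (P u)).

(* Riemann tensor of E(kappa, tau): the curvature form sends the bivector     *)
(* q = P_0 /\ P_1 to w |-> (- tau^2 q - c <q, xi> xi) /\ w.                    *)
Lemma frame_curvature u : U u -> ambient_curvature Om u =
  cross_mx (- (tau ^+ 2 * q u 0 0)) (- (tau ^+ 2 * q u 0 1))
           (- (tau ^+ 2 * q u 0 2) - c * q u 0 2).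
Proof.
move=> Uu; rewrite /ambient_curvature.
have srow i : smooth_mx U (fun v => row i (P v)).
  by move=> a b; apply: (smooth_on_eq oU _ (sP i b)) => v _; rewrite [RHS]mxE.
have drow k i a : partial_mx k (fun v => row i (P v)) u 0 a = partial_mx k P u i a.
  by rewrite [LHS]mxE [RHS]mxE; congr (partial k _ u); apply/funext => v; rewrite [LHS]mxE.
(* Absence of torsion trades d_0 P_1 for d_1 P_0 plus terms of order zero in [P], so the derivatives
   of [P] cancel in the curvature. *)
have T a : partial_mx 0 P u 1 a = partial_mx 1 P u 0 a + (P u *m Om 1 u) 0 a
    - (P u *m Om 0 u) 1 a.
  have := tors Uu 0 1 a; rewrite /cov_tangent !addmxE => <-.
  by rewrite addrK.
rewrite (partial_conn 0 (srow 1) Uu) (partial_conn 1 (srow 0) Uu).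
have X0 := partial_X_frame 0 Uu; have X1 := partial_X_frame 1 Uu.
rewrite !X0 !X1 {X0 X1}.
have dP01 a : partial_mx 0 (fun v => row 1 (P v)) u 0 a = partial_mx 1 P u 0 a
   + \sum_b P u 0 b * Om 1 u b a - \sum_b P u 1 b * Om 0 u b a.
  by rewrite drow T; congr (_ + _ - _); rewrite [LHS]mxE.
have dP10 a : partial_mx 1 (fun v => row 0 (P v)) u 0 a = partial_mx 1 P u 0 a.
  exact: drow.
move: dP01 dP10; move: (partial_mx 0 _ _) (partial_mx 1 _ _) (partial_mx 1 P u).
move=> d1 d0 D E1 E0.
have {E1} E1 a := E1 a; have {E0} E0 a := E0 a.
rewrite /row_cross /frame_conn in E1 *; rewrite /ekt_conf.
move: (P u) E1 => p E1.
apply/matrixP; elim/ord3_ind; elim/ord3_ind;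
  rewrite !(addmxE, oppmxE) !mxE !sum_ord3 !mxE !ord3_valE /= ?E1 ?E0 ?sum_ord3 ?mxE ?ord3_valE /=.
all: by field.
Qed.

End EktSurface.

(** In dimension two the contribution of the shape operator is det S times the area form, as is the
    ambient one with factor [x]; the Gauss curvature det S + x thus factors out. *)
Lemma gauss_tensor_algebra (R : comNzRingType) (g S : 'M[R]_2) (x : R) : g^T = g ->
  mx2 0 (- (\det g * x)) (\det g * x) 0
  - (- (g *m (col 1 S) *m (col 0 S)^T *m g) + g *m (col 0 S) *m (col 1 S)^T *m g) =
  (mx2 ((\det S + x) * g 0 1) ((\det S + x) * g 1 1)
       (- ((\det S + x) * g 0 0)) (- ((\det S + x) * g 0 1)))^T *m g.
Proof.
move=> g_sym; have g10 : g 1 0 = g 0 1 by rewrite -[in LHS]g_sym mxE.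
apply/matrixP; elim/ord2_ind; elim/ord2_ind; rewrite !det_mx2 !(addmxE, oppmxE)
  !mxE !sum_ord2 !mxE !big_ord1 !mxE !sum_ord2 !mxE ?eqxx ?ord2_eqE ?g10; ring.
Qed.

(** * The Simons-type identity in a moving frame *)

Section EktMovingFrame.
Context (R : realType) (kappa tau : R) (U : set 'rV[R]_2).
Hypothesis oU : open U.
Context (P : 'rV[R]_2 -> 'M[R]_(2, 3)) (N : 'rV[R]_2 -> 'rV[R]_3)
  (Om : 'I_2 -> 'rV[R]_2 -> 'M[R]_3).
Hypothesis sP : smooth_mx U P.
Hypothesis sN : smooth_mx U N.
Hypothesis sOm : forall i, smooth_mx U (Om i).
Hypothesis anti : forall i u, (Om i u)^T = - Om i u.
Hypothesis tors : forall u, U u ->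
  forall i j a, cov_tangent P Om i u j a = cov_tangent P Om j u i a.
Hypothesis N_unit : forall u, U u -> N u *m (N u)^T = 1%:M.
Hypothesis N_orth : forall u, U u -> P u *m (N u)^T = 0.
Hypothesis gU : forall u, U u -> gram P u \in unitmx.

Local Notation c := (kappa - 4 * tau ^+ 2).
Local Notation g := (gram P).
Local Notation wg := (weingarten P N Om).
Local Notation L := (conn_form P).
Local Notation C := (fun u => N u 0 2).
Local Notation s := (fun u => row_area (P u) (N u)).

Hypothesis curvature : forall u, U u -> ambient_curvature Om u =
  cross_mx (- (tau ^+ 2 * row_cross (P u) 0 0)) (- (tau ^+ 2 * row_cross (P u) 0 1))
           (- (tau ^+ 2 * row_cross (P u) 0 2) - c * row_cross (P u) 0 2).
(* The covariant derivative of the last frame vector xi is tau (X /\ xi). *)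
Hypothesis nabla_xi : forall i u (w : 'rV[R]_3),
  (w *m Om i u) 0 2 = tau * (P u i 0 * w 0 1 - P u i 1 * w 0 0).

(** Here the rows of the moving frame become columns, the convention of [endo]; [christoffel_mx] is
    transposed for the same reason. *)
Definition shape_mx u : 'M[R]_2 := \matrix_(k, i) wg i u 0 k.
Definition christoffel_mx k u : 'M[R]_2 := (L k u)^T.
(** Lowered components <xi, d_k X> of T: xi is the last frame vector. *)
Definition xi_row u : 'rV[R]_2 := \row_k P u k 2.

Local Notation G := christoffel_mx.
Local Notation T := xi_row.

Lemma smooth_shape : smooth_mx U shape_mx.
Proof.
move=> k i; apply: (smooth_on_eq oU _ (smooth_weingarten oU sP sN sOm gU i 0 k)).
by move=> u _; rewrite [RHS]mxE.
Qed.

Lemma smooth_christoffel_mx k : smooth_mx U (G k).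
Proof. exact: (smooth_mx_tr oU (smooth_conn_form oU sP sOm anti tors gU k)). Qed.

Lemma christoffel_mxE k u i l : G k u i l = christoffel g u i k l.
Proof. by rewrite !mxE. Qed.

Lemma christoffel_mx_sym k l m u : G k u m l = G l u m k.
Proof. by rewrite !christoffel_mxE; apply: christoffel_sym => v; exact: gram_sym. Qed.

Lemma gram_shapeE u i j : U u -> (g u *m shape_mx u) j i = second_form P N Om i u j 0.
Proof.
move=> Uu; rewrite (second_formE oU sP sN anti N_unit N_orth gU i Uu) mxE [RHS]mxE.
by apply: eq_bigr => a _; congr (_ * _); rewrite [LHS]mxE [RHS]mxE.
Qed.

Lemma gram_shape_sym u : U u -> (g u *m shape_mx u)^T = g u *m shape_mx u.
Proof.
move=> Uu; apply/matrixP => i j; rewrite [LHS]mxE !gram_shapeE //.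
exact: (second_form_sym N tors i j Uu).
Qed.

Lemma partial_gram_christoffel k u : U u ->
  partial_mx k g u = (G k u)^T *m g u + g u *m G k u.
Proof.
by move=> Uu; rewrite (partial_gramE oU sP anti tors gU k Uu) /christoffel_mx trmxK.
Qed.

(** The Codazzi tensor c C (<Y, T> X - <X, T> Y) at X = d_0, Y = d_1. *)
Definition codazzi_col u : 'cV[R]_2 :=
  \col_a (if a == 0 then c * C u * T u 0 1 else - (c * C u * T u 0 0)).

Lemma shape_codazzi u a : U u ->
  nabla G 0 shape_mx u a 1 - nabla G 1 shape_mx u a 0 = codazzi_col u a 0.
Proof.
move=> Uu; rewrite [RHS]mxE.
have := codazzi_equation oU sP sN sOm anti tors N_unit N_orth gU Uu.
rewrite (curvature Uu); set Z := (X in X *m _) => e.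
have eZ : Z = - (c * C u) *: \row_k (if k == 0 then T u 0 1 else - T u 0 0).
  apply: (can_inj (mulmxK (gU Uu))); rewrite e; apply/rowP => l.
  rewrite (normal_curvature (N_unit Uu) (N_orth Uu)).
  rewrite -scalemxAl [RHS]mxE [in RHS]mxE sum_ord2 -/(gram P u).
  have rE k : (\row_k (if k == 0 then T u 0 1 else - T u 0 0)) 0 k =
      if k == 0 then T u 0 1 else - T u 0 0 by rewrite mxE.
  by rewrite !rE /= ![T u _ _]mxE; move: (g u) => g0; ring.
have dS i k : partial_mx k shape_mx u a i = partial_mx k (wg i) u 0 a.
  rewrite [LHS]mxE [RHS]mxE; congr (partial k _ u); apply/funext => v.
  by rewrite [LHS]mxE.
(* The terms S G of the two covariant derivatives cancel by symmetry of the Christoffel symbols. *)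
have -> : nabla G 0 shape_mx u a 1 - nabla G 1 shape_mx u a 0 = - Z 0 a.
  rewrite /nabla /Z !(addmxE, oppmxE) !dS.
  move: (partial_mx 0 (wg 1) u) (partial_mx 1 (wg 0) u) => d1 d0.
  rewrite !mxE !sum_ord2 ![shape_mx u _ _]mxE (christoffel_mx_sym 1 0 0 u).
  by rewrite (christoffel_mx_sym 1 0 1 u) ![G _ _ a _]mxE; ring.
by rewrite eZ !mxE; case: ifP => _; ring.
Qed.

(** C is the last component of [N], so its derivative is the last column of the Weingarten formula.
    The second term is -tau <J T, d_l X>, where s / det g = 1 / s. *)
Lemma partial_angle l u : U u -> partial l (fun v => N v 0 2) u =
  - (T u *m shape_mx u) 0 l
  + tau * s u / \det (g u) * (T u 0 1 * g u 0 l - T u 0 0 * g u 1 l).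
Proof.
move=> Uu; have := partial_normal oU sN anti N_unit N_orth gU l Uu.
move/matrixP => /(_ 0 2); rewrite [LHS]mxE => ->.
rewrite addmxE !oppmxE nabla_xi [(wg l u *m P u) 0 2]mxE [(T u *m shape_mx u) 0 l]mxE.
have d0 : \det (g u) != 0 by rewrite -unitfE -unitmxE gU.
have := row_cross_xi (N_unit Uu) (N_orth Uu) l; rewrite -/(gram P u) => e.
rewrite ![T u _ _]mxE e.
have -> : tau * s u / \det (g u) * (s u * (P u l 1 * N u 0 0 - P u l 0 * N u 0 1)) =
    tau * (s u ^+ 2 / \det (g u)) * (P u l 1 * N u 0 0 - P u l 0 * N u 0 1) by ring.
rewrite (row_area_sqr (N_unit Uu) (N_orth Uu)) divff // !sum_ord2 !mxE; ring.
Qed.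

(** Last column of the Gauss formula; in covariant form, nabla T = C (A - tau J). *)
Lemma partial_xi_row l j u : U u -> partial l (fun v => P v j 2) u =
  \sum_k G l u k j * T u 0 k + (g u *m shape_mx u) j l * C u
  - tau * s u * C u * (((l == 0) && (j == 1))%:R - ((l == 1) && (j == 0))%:R).
Proof.
move=> Uu; have := partial_tangent oU sP anti tors N_unit N_orth gU l Uu.
move/matrixP => /(_ j 2); rewrite [LHS]mxE => ->.
rewrite !addmxE oppmxE; congr (_ + _ - _).
- by rewrite mxE; apply: eq_bigr => k _; rewrite [G _ _ _ _]mxE [T _ _ _]mxE.
- by rewrite mxE big_ord1 gram_shapeE.
- have -> : (P u *m Om l u) j 2 = (row j (P u) *m Om l u) 0 2 by rewrite -row_mul [RHS]mxE.
  rewrite nabla_xi ![row j _ _ _]mxE.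
  by rewrite (row_area_cross (N_unit Uu) (N_orth Uu) l j); ring.
Qed.

(** The right-hand side is the matrix of Z |-> K (<d_1, Z> d_0 - <d_0, Z> d_1). *)
Lemma shape_ricci u : U u ->
  let K := \det (shape_mx u) + tau ^+ 2 + c * C u ^+ 2 in
  partial_mx 0 (G 1) u - partial_mx 1 (G 0) u + G 0 u *m G 1 u - G 1 u *m G 0 u =
  mx2 (K * g u 0 1) (K * g u 1 1) (- (K * g u 0 0)) (- (K * g u 0 1)).
Proof.
move=> Uu K.
have := gauss_equation oU sP sN sOm anti tors N_unit N_orth gU Uu.
rewrite (curvature Uu) (tangent_curvature (N_unit Uu) (N_orth Uu)) -/(gram P u).
rewrite (second_formE oU sP sN anti N_unit N_orth gU 0 Uu).
rewrite (second_formE oU sP sN anti N_unit N_orth gU 1 Uu).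
set Z := _ - _ + _ - _ => e.
have eZ : Z = (mx2 (K * g u 0 1) (K * g u 1 1) (- (K * g u 0 0)) (- (K * g u 0 1)))^T.
  apply: (can_inj (mulmxK (gU Uu))).
  move: e; rewrite mulmxDl mulmxBl => /eqP.
  rewrite -addrA eq_sym -subr_eq eq_sym => /eqP ->.
  have wgE i : wg i u = (col i (shape_mx u))^T.
    by apply/rowP => k; rewrite [RHS]mxE [RHS]mxE [RHS]mxE.
  rewrite !wgE !trmxK /K -addrA -gauss_tensor_algebra ?gram_sym //.
rewrite !(partial_mx_tr _ (L _)) /christoffel_mx -!trmx_mul.
rewrite -[RHS]trmxK -eZ /Z !raddfB raddfD raddfB /=.
by [].
Qed.

(** The Christoffel terms in the derivative of T cancel those of [nabla_codazzi], so only covariant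
    derivatives remain. *)
Lemma shape_codazzi_derivative l u (a : 'I_2) : U u ->
  let dC := - (T u *m shape_mx u) 0 l
    + tau * s u / \det (g u) * (T u 0 1 * g u 0 l - T u 0 0 * g u 1 l) in
  let dT j := (g u *m shape_mx u) j l * C u
    - tau * s u * C u * (((l == 0) && (j == 1))%:R - ((l == 1) && (j == 0))%:R) in
  nabla2 G shape_mx l 0 u a 1 - nabla2 G shape_mx l 1 u a 0 =
  if a == 0 then c * (dC * T u 0 1 + C u * dT 1) else - (c * (dC * T u 0 0 + C u * dT 0)).
Proof.
move=> Uu dC dT.
rewrite (nabla_codazzi oU smooth_christoffel_mx smooth_shape l shape_codazzi Uu).
have sC := sN 0 2; have sT j := sP j 2.
have dCT j : partial l (fun v => c * N v 0 2 * P v j 2) u =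
    c * (dC * T u 0 j + C u * (\sum_k G l u k j * T u 0 k + dT j)).
  have scC := smooth_onM oU (smooth_on_cst oU c) sC.
  rewrite (partialM l scC (sT j) Uu) (partialM l (smooth_on_cst oU c) sC Uu).
  rewrite partial_cst mul0r add0r (partial_angle l Uu) (partial_xi_row l j Uu).
  by rewrite -/dC [T u 0 j]mxE /dT addrA; ring.
have dcol b : partial_mx l codazzi_col u b 0 =
    if b == 0 then c * (dC * T u 0 1 + C u * (\sum_k G l u k 1 * T u 0 k + dT 1))
    else - (c * (dC * T u 0 0 + C u * (\sum_k G l u k 0 * T u 0 k + dT 0))).
  have sv : smooth_on U (fun v => c * N v 0 2 * P v 0 2) :=
    smooth_onM oU (smooth_onM oU (smooth_on_cst oU c) sC) (sT 0).
  have vE v : codazzi_col v b 0 =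
      if b == 0 then c * N v 0 2 * P v 1 2 else - (c * N v 0 2 * P v 0 2).
    by rewrite mxE [T v 0 1]mxE [T v 0 0]mxE.
  rewrite mxE (partial_eq_on oU l (fun v _ => vE v) Uu) -!dCT -(partialN l sv Uu).
  by case: (b == 0).
have cE b j : codazzi_col u b j =
    if b == 0 then c * C u * T u 0 1 else - (c * C u * T u 0 0) by rewrite mxE.
rewrite dcol [(G l u *m _) a 0]mxE /mxtrace !sum_ord2 !cE.
by elim/ord2_ind: a; rewrite /=; ring.
Qed.

(** Decompose xi into its tangential and normal parts and pair the result with xi. *)
Lemma xi_tangent_norm u : U u ->
  (T u *m invmx (g u) *m (T u)^T) 0 0 = 1 - C u ^+ 2.
Proof.
move=> Uu; pose w : 'rV[R]_3 := delta_mx 0 2.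
have wP : w *m (P u)^T = T u by rewrite -rowE; apply/rowP => k; rewrite !mxE.
have wN : w *m (N u)^T = (N u 0 2)%:M.
  by rewrite -rowE; apply/matrixP => i j; rewrite (ord1 i) (ord1 j) !mxE.
have Pw : P u *m w^T = (T u)^T by rewrite -wP trmx_mul trmxK.
have Nw : N u *m w^T = (N u 0 2)%:M by rewrite -[LHS]trmxK trmx_mul trmxK wN tr_scalar_mx.
have ww : (w *m w^T) 0 0 = 1 by rewrite -rowE !mxE.
have := frame_decomposition N_unit N_orth gU w Uu.
move=> /(congr1 (mulmx^~ w^T)) /matrixP /(_ 0 0).
rewrite mulmxDl addmxE wP ww -!mulmxA Pw Nw mul_mx_scalar -scalemxAr wN => ->.
have -> : ((N u 0 2) *: (N u 0 2)%:M : 'M[R]_1) 0 0 = N u 0 2 ^+ 2.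
  by rewrite mxE mxE mulr1n expr2.
by rewrite addrK.
Qed.

Lemma hess_gram f u : hess g f u = invmx (g u) *m \matrix_(l, k)
  (partial l (partial k f) u - \sum_m G l u m k * partial m f u).
Proof.
rewrite /hess; congr (_ *m _); apply/matrixP => l k; rewrite [LHS]mxE [RHS]mxE.
by congr (_ - _); apply: eq_bigr => m _; rewrite christoffel_mxE.
Qed.

Theorem simons_frame u (e : 'I_2 -> 'rV[R]_2) : U u -> orthonormal_frame (g u) e ->
  let S := shape_mx u in
  let xi := T u *m invmx (g u) in
  let Phi := S - (2^-1 * \tr S)%:M in
  let PhiT := xi *m Phi^T in
  \tr (((\tr S)%:M - S) *m hess g (fun v => \tr (shape_mx v)) u) =
  \tr (hess g (fun v => \det (shape_mx v)) u)
  + \sum_i \sum_j gdot (g u) (endo (\sum_k e j 0 k *: nabla G k shape_mx u) (e i))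
                         (endo (\sum_k e j 0 k *: nabla G k shape_mx u) (e i))
  - 4 * gdot (g u) (grad g (fun v => 2^-1 * \tr (shape_mx v)) u)
                   (grad g (fun v => 2^-1 * \tr (shape_mx v)) u)
  + \tr (Phi *m Phi) * (2 * \det S + c * (5 * C u ^+ 2 - 1) + 2 * tau ^+ 2)
  - 2 * c * (2^-1 * \tr S * (PhiT *m (T u)^T) 0 0
             + tau * (s u * (PhiT 0 1 * xi 0 0 - PhiT 0 0 * xi 0 1))).
Proof.
move=> Uu eo S xi Phi PhiT.
have sG := smooth_christoffel_mx; have sS := smooth_shape.
have d0 : \det (g u) != 0 by rewrite -unitfE -unitmxE gU.
have sg := smooth_gram oU sP.
have gsym v : U v -> (g v)^T = g v by move=> _; exact: gram_sym.
have sB k : (g u *m nabla G k shape_mx u)^T = g u *m nabla G k shape_mx u.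
  exact: (nabla_selfadjoint oU sg sS (partial_gram_christoffel k) gsym gram_shape_sym Uu).
have sD l k : (g u *m nabla2 G shape_mx l k u)^T = g u *m nabla2 G shape_mx l k u.
  exact: (nabla2_selfadjoint oU sG sS l k sg partial_gram_christoffel gsym gram_shape_sym Uu).
have first := first_order_algebra (gsym u Uu) d0 sB eo.
have gradE : grad g (fun v => 2^-1 * \tr (shape_mx v)) u =
    (\row_k (2^-1 * \tr (nabla G k shape_mx u))) *m invmx (g u).
  congr (_ *m _); apply/rowP => k; rewrite [LHS]mxE [RHS]mxE.
  rewrite (partialM k (smooth_on_cst oU 2^-1) (smooth_mxtrace oU sS) Uu).
  by rewrite partial_cst mul0r add0r (partial_trace oU G sS k Uu).
rewrite -gradE in first.
have second := @simons_algebra R (g u) S (gsym u Uu) d0 (gram_shape_sym Uu) kappa tau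
  (C u) (s u) (fun l k => nabla2 G shape_mx l k u) (T u) sD
  (fun l => shape_codazzi_derivative l 0 Uu) (fun l => shape_codazzi_derivative l 1 Uu).
have ric : nabla2 G shape_mx 0 1 u - nabla2 G shape_mx 1 0 u = _ :=
  ricci_identity oU sG sS christoffel_mx_sym Uu.
rewrite (shape_ricci Uu) in ric.
have {second ric} second := second ric (xi_tangent_norm Uu).
have hT : hess g (fun v => \tr (shape_mx v)) u =
    invmx (g u) *m \matrix_(l, k) \tr (nabla2 G shape_mx l k u).
  rewrite hess_gram; congr (_ *m _); apply/matrixP => l k; rewrite [LHS]mxE [RHS]mxE.
  exact: (hessian_trace oU sG sS l k Uu).
have hD : hess g (fun v => \det (shape_mx v)) u =
    invmx (g u) *m (\matrix_(l, k) det_polar (nabla G l shape_mx u) (nabla G k shape_mx u)) +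
    invmx (g u) *m (\matrix_(l, k) det_polar S (nabla2 G shape_mx l k u)).
  rewrite hess_gram -mulmxDr; congr (_ *m _); apply/matrixP => l k.
  rewrite [LHS]mxE addmxE (hessian_det oU sG sS l k Uu).
  by congr (_ + _); rewrite [RHS]mxE.
(* [A] is Box(2H), [B1] and [B2] are the first- and second-order parts of Lap K_e, [F] is |nabla
   A|^2 and [Gr] is 4 |grad H|^2. *)
have combine (A B1 B2 F Gr Q1 Q2 : R) :
    A - B2 = Q1 - Q2 -> B1 + F = Gr -> A = B1 + B2 + F - Gr + Q1 - Q2 by lra.
rewrite hT hD raddfD /=; exact: combine second first.
Qed.

End EktMovingFrame.

(** * Return to the coordinate expressions *)

Section ParametrizedFormula.
Context (R : realType) (kappa tau : R) (U : set 'rV[R]_2).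
Hypothesis oU : open U.
Context (X N : 'rV[R]_2 -> 'rV[R]_3).
Hypothesis sX : smooth_mx U X.
Hypothesis sN : smooth_mx U N.
Hypothesis X_dom : forall u, U u -> ekt_dom kappa (X u).
Hypothesis N_unit : forall u, U u -> gdot (amb kappa tau X u) (N u) (N u) = 1.
Hypothesis N_orth : forall u, U u ->
  forall i, gdot (amb kappa tau X u) (N u) (partial i X u) = 0.
Hypothesis X_imm : forall u, U u -> \rank (jac X u) = 2%N.

Local Notation P := (frame_tangent kappa tau X).
Local Notation n := (frame_normal kappa tau X N).
Local Notation Om := (frame_conn kappa tau X).
Local Notation Sh := (shape_mx P n Om).
Local Notation g := (first_form kappa tau X).

Lemma frame_conn_xi i u (w : 'rV[R]_3) :
  (w *m Om i u) 0 2 = tau * (P u i 0 * w 0 1 - P u i 1 * w 0 0).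
Proof.
rewrite /frame_conn /conn; move: (P u) => p.
by rewrite mxE sum_ord3 !mxE !ord3_valE /=; ring.
Qed.

Lemma xi_frame u : ekt_xi R *m frame kappa tau (X u) = delta_mx 0 2.
Proof.
rewrite /ekt_xi -rowE; apply/rowP; elim/ord3_ind; by rewrite !mxE !ord3_valE.
Qed.

Lemma shape_op_shape u : U u -> shape_op kappa tau X N u = Sh u.
Proof. by move=> Uu; rewrite (shape_opE tau oU sX sN X_dom Uu). Qed.

Lemma mean_curv_shape u : U u -> mean_curv kappa tau X N u = 2^-1 * \tr (Sh u).
Proof. by move=> Uu; rewrite /mean_curv shape_op_shape. Qed.

Lemma hess_eq_on (h : 'rV[R]_2 -> 'M[R]_2) (f f' : 'rV[R]_2 -> R) u :
  (forall v, U v -> f v = f' v) -> U u -> hess h f u = hess h f' u.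
Proof.
move=> ff Uu; have e k v (Uv : U v) := partial_eq_on oU k ff Uv.
rewrite /hess; congr (_ *m _); apply/matrixP => i j; rewrite [LHS]mxE [RHS]mxE.
congr (_ - _); first exact: (partial_eq_on oU i (e j) Uu).
by apply: eq_bigr => k _; rewrite (e k u Uu).
Qed.

Lemma grad_eq_on (h : 'rV[R]_2 -> 'M[R]_2) (f f' : 'rV[R]_2 -> R) u :
  (forall v, U v -> f v = f' v) -> U u -> grad h f u = grad h f' u.
Proof.
move=> ff Uu; congr (_ *m _); apply/rowP => k; rewrite [LHS]mxE [RHS]mxE.
exact: (partial_eq_on oU k ff Uu).
Qed.

Lemma nabla_endo_shape k u : U u ->
  nabla_endo g (shape_op kappa tau X N) u k = nabla (christoffel_mx P) k Sh u.
Proof.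
move=> Uu; rewrite first_form_gram; apply/matrixP => i j.
rewrite [LHS]mxE /nabla !(addmxE, oppmxE) (shape_op_shape Uu).
congr (_ + _ - _).
- rewrite [RHS]mxE; apply: (partial_eq_on oU k _ Uu) => v Uv.
  by rewrite shape_op_shape.
- by rewrite [RHS]mxE; apply: eq_bigr => l _; rewrite christoffel_mxE.
- by rewrite [RHS]mxE; apply: eq_bigr => l _; rewrite christoffel_mxE mulrC.
Qed.

Lemma tan_coordE u (w : 'rV[R]_3) :
  tan_coord kappa tau X u w =
  (w *m frame kappa tau (X u) *m (P u)^T) *m invmx (gram P u).
Proof.
rewrite /tan_coord first_form_gram; congr (_ *m _); apply/rowP => k.
rewrite mxE gdot_frame -(row_frame_tangent kappa tau X k u) [LHS]mxE [RHS]mxE.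
by apply: eq_bigr => a _; congr (_ * _); rewrite [LHS]mxE [LHS]mxE [RHS]mxE.
Qed.

Lemma angle_fun_frame u : angle_fun kappa tau X N u = n u 0 2.
Proof.
rewrite /angle_fun gdot_frame xi_frame.
by rewrite mxE sum_ord3 !mxE !ord3_eqE /= !mulr0 mulr1 !add0r.
Qed.

Lemma xi_tan_frame u : U u ->
  xi_tan kappa tau X N u = xi_row P u *m invmx (gram P u).
Proof.
move=> Uu; rewrite /xi_tan tan_coordE; congr (_ *m _).
have nP : n u *m (P u)^T = 0.
  by rewrite -[LHS]trmxK trmx_mul trmxK (frame_normal_orth N_orth Uu) trmx0.
rewrite mulmxBl xi_frame -scalemxAl mulmxBl -scalemxAl -/(n u) nP scaler0 subr0 -rowE.
by apply/rowP => k; rewrite !mxE.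
Qed.

Lemma row_det3 (v w z : 'rV[R]_3) :
  \det (\matrix_(i < 3) nth 0 [:: v; w; z] i) =
  (v 0 1 * w 0 2 - v 0 2 * w 0 1) * z 0 0 + (v 0 2 * w 0 0 - v 0 0 * w 0 2) * z 0 1
  + (v 0 0 * w 0 1 - v 0 1 * w 0 0) * z 0 2.
Proof. by rewrite det_mx3 !mxE !ord3_valE /=; ring. Qed.

(** The coordinate frame is positively oriented: the root of the determinant of the metric is det th
    itself, because det th > 0. Hence the volume form is the ordinary determinant in frame
    components. *)
Lemma vprod_frame u (v w z : 'rV[R]_3) : U u ->
  gdot (amb kappa tau X u) (vprod (amb kappa tau X u) v w) z =
  \det (\matrix_(i < 3) nth 0 [:: v *m frame kappa tau (X u);
    w *m frame kappa tau (X u); z *m frame kappa tau (X u)] i).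
Proof.
move=> Uu; set th := frame kappa tau (X u).
have Dx := X_dom Uu; have thU : th \in unitmx by exact: frame_unit.
have gE : amb kappa tau X u = th *m th^T by exact: ekt_metricE.
have gUn : amb kappa tau X u \in unitmx by rewrite gE unitmx_mul unitmx_tr thU.
have dth : 0 < \det th.
  by rewrite det_frame exprn_gt0 // invr_gt0; exact: Dx.
rewrite /gdot /vprod mulmxKV //.
have -> : Num.sqrt (\det (amb kappa tau X u)) = \det th.
  by rewrite gE det_mulmx det_tr -expr2 sqrtr_sqr gtr0_norm.
have -> : (\matrix_(i < 3) nth 0 [:: v *m th; w *m th; z *m th] i) =
    (\matrix_(i < 3) nth 0 [:: v; w; z] i) *m th.
  apply/row_matrixP => i; rewrite row_mul !rowK.
  by elim/ord3_ind: i; rewrite !ord3_valE.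
rewrite det_mulmx mulrC -scalemxAl mxE; congr (_ * _).
rewrite mxE sum_ord3 row_det3 !mxE !row_det3 !mxE !ord3_eqE !eqxx /=.
ring.
Qed.

(** The raising of the index in [rotJ] cancels against g, leaving the triple products of
    [row_area_normal]; their sign depends on the orientation of the chart. *)
Lemma rotJ_frame u (x y : 'rV[R]_2) : U u ->
  gdot (g u) y (rotJ kappa tau X N u x) =
  row_area (P u) (n u) * (y 0 1 * x 0 0 - y 0 0 * x 0 1).
Proof.
move=> Uu.
have gUn : gram P u \in unitmx by exact: (frame_gram_unit tau X_dom X_imm Uu).
rewrite /rotJ /tan_coord /gdot first_form_gram trmx_mul trmx_inv gram_sym.
rewrite mulmxA mulmxK // mxE sum_ord2.
have E k : (\row_k gdot (amb kappa tau X u)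
      (vprod (amb kappa tau X u) (N u) (x *m jac X u)) (partial k X u))^T k 0 =
    row_area (P u) (n u) * (x 0 0 * (k == 1)%:R - x 0 1 * (k == 0)%:R).
  rewrite mxE mxE vprod_frame // -mulmxA -/(frame_tangent kappa tau X u) -/(n u).
  rewrite -(row_frame_tangent kappa tau X k u) row_det3.
  have nl l := row_area_normal (P u) (n u) l k.
  have xE b : (x *m P u) 0 b = x 0 0 * P u 0 b + x 0 1 * P u 1 b.
    by rewrite mxE sum_ord2.
  rewrite !xE ![row k (P u) 0 _]mxE.
  transitivity (x 0 0 * (row_area (P u) (n u) * (((0 == 0 :> 'I_2) && (k == 1))%:R
     - ((0 == 1 :> 'I_2) && (k == 0))%:R)) + x 0 1 * (row_area (P u) (n u) *
     (((1 == 0 :> 'I_2) && (k == 1))%:R - ((1 == 1 :> 'I_2) && (k == 0))%:R))).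
    by rewrite -!nl; ring.
  by rewrite /=; ring.
by rewrite !E /=; ring.
Qed.

Theorem parametrized_formula u (e : 'I_2 -> 'rV[R]_2) : U u ->
  let H := mean_curv kappa tau X N in
  let Ke := ext_curv kappa tau X N in
  let C := angle_fun kappa tau X N u in
  let T := xi_tan kappa tau X N u in
  let PhiT := endo (Phi kappa tau X N u) T in
  let JT := rotJ kappa tau X N u T in
  orthonormal_frame (g u) e ->
  cheng_yau kappa tau X N (fun v => 2 * H v) u =
    laplacian g Ke u + nablaA_sq kappa tau X N u e
    - 4 * grad_sq kappa tau X H u
    + Phi_sq kappa tau X N u *
      (2 * Ke u + (kappa - 4 * tau ^+ 2) * (5 * C ^+ 2 - 1) + 2 * tau ^+ 2)
    - 2 * (kappa - 4 * tau ^+ 2) *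
      (H u * gdot (g u) PhiT T + tau * gdot (g u) PhiT JT).
Proof.
move=> Uu H Ke C T PhiT JT eo.
have eo' : orthonormal_frame (gram P u) e by rewrite -first_form_gram.
have gUn : gram P u \in unitmx by exact: (frame_gram_unit tau X_dom X_imm Uu).
have := simons_frame oU (smooth_frame_tangent tau oU sX X_dom)
  (smooth_frame_normal tau oU sX sN X_dom) (smooth_frame_conn tau oU sX X_dom)
  (frame_conn_antisym kappa tau X) (frame_torsion_free tau oU sX X_dom)
  (frame_normal_unit N_unit) (frame_normal_orth N_orth) (frame_gram_unit tau X_dom X_imm)
  (frame_curvature tau oU sX X_dom) frame_conn_xi Uu eo'.
have twoH v : U v -> 2 * mean_curv kappa tau X N v = \tr (Sh v).
  by move=> Uv; rewrite (mean_curv_shape Uv); field.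
have SE := shape_op_shape Uu.
have e1 : cheng_yau kappa tau X N (fun v => 2 * mean_curv kappa tau X N v) u =
    \tr (((\tr (Sh u))%:M - Sh u) *m hess (gram P) (fun v => \tr (Sh v)) u).
  by rewrite /cheng_yau (hess_eq_on g twoH Uu) (twoH u Uu) SE first_form_gram.
have e2 : laplacian g (ext_curv kappa tau X N) u =
    \tr (hess (gram P) (fun v => \det (Sh v)) u).
  rewrite /laplacian first_form_gram; congr (\tr _).
  by apply: hess_eq_on => // v Uv; rewrite /ext_curv (shape_op_shape Uv).
have e3 : nablaA_sq kappa tau X N u e =
    \sum_i \sum_j gdot (gram P u)
      (endo (\sum_k e j 0 k *: nabla (christoffel_mx P) k Sh u) (e i))
      (endo (\sum_k e j 0 k *: nabla (christoffel_mx P) k Sh u) (e i)).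
  rewrite /nablaA_sq; apply: eq_bigr => i _; apply: eq_bigr => j _.
  rewrite /nablaA.
  have -> : \sum_k e j 0 k *: nabla_endo g (shape_op kappa tau X N) u k =
      \sum_k e j 0 k *: nabla (christoffel_mx P) k Sh u.
    by apply: eq_bigr => k _; rewrite (nabla_endo_shape k Uu).
  by rewrite first_form_gram.
have e4 : grad_sq kappa tau X (mean_curv kappa tau X N) u =
    gdot (gram P u) (grad (gram P) (fun v => 2^-1 * \tr (Sh v)) u)
                    (grad (gram P) (fun v => 2^-1 * \tr (Sh v)) u).
  by rewrite /grad_sq (grad_eq_on g mean_curv_shape Uu) first_form_gram.
have e5 : Phi kappa tau X N u = Sh u - (2^-1 * \tr (Sh u))%:M.
  by rewrite /Phi SE (mean_curv_shape Uu).
have e6 : ext_curv kappa tau X N u = \det (Sh u) by rewrite /ext_curv SE.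
rewrite {}/JT {}/PhiT {}/T {}/C {}/Ke {}/H (rotJ_frame _ _ Uu) /Phi_sq e1 e2 e3 e4 e5 e6.
rewrite (mean_curv_shape Uu) angle_fun_frame (xi_tan_frame Uu) first_form_gram.
have gd y : gdot (gram P u) y (xi_row P u *m invmx (gram P u)) = (y *m (xi_row P u)^T) 0 0.
  by rewrite /gdot trmx_mul trmx_inv gram_sym mulmxA mulmxK.
by rewrite gd.
Qed.

End ParametrizedFormula.

(** * Domains of local representations *)

Section LocalDomain.
Context (R : realType) (kappa tau : R) (E : ekt_space kappa tau) (S : surface E).
Context (a : chart R 2 S) (b : chart R 3 E).
Hypothesis ha : satlas a.
Hypothesis hb : ekt_atlas b.

Local Notation f := (@simm R kappa tau E S).
Local Notation U := (locdom a b f).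

Lemma locdom_cinv u : U u ->
  [/\ cdom a (cinv a u), cdom b (f (cinv a u)) & cmap a (cinv a u) = u].
Proof.
have [_ _ charts _ _] := smanifold S; have [_ _ _ _ cK] := charts a ha.
by move=> [p [ap bp] <-]; rewrite cK.
Qed.

Lemma locdom_open : open U.
Proof.
have [_ _ charts _ _] := smanifold S.
have [oda oca _ cinv_cont cK] := charts a ha.
have [_ _ echarts _ _] := ekt_manifold E.
have [odb _ _ _ _] := echarts b hb.
have oW : open (cdom a `&` f @^-1` cdom b).
  by apply: openI => //; apply: open_comp odb => p _; exact: (simm_smooth S).1.
rewrite openE => u Uu; have [ap bp uK] := locdom_cinv Uu.
have ccu : ccod a u by exists (cinv a u).
(* Since [ccod a] is open, continuity relative to it is continuity at each of its points. *)
have := cinv_cont.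
rewrite continuous_open_subspace // => /(_ u); rewrite inE => /(_ ccu) ccont.
have nW : nbhs (cinv a u) (cdom a `&` f @^-1` cdom b) by apply: open_nbhs_nbhs.
have nu : nbhs u (cinv a @^-1` (cdom a `&` f @^-1` cdom b)) := ccont _ nW.
have nc : nbhs u (ccod a) by apply: open_nbhs_nbhs.
rewrite /interior /=; apply: filterS (filterI nu nc) => v [[av bv] [q aq qv]].
by exists (cinv a v) => //; rewrite -qv cK.
Qed.

End LocalDomain.

Theorem proposition3p2 (R : realType) (kappa tau : R)
    (hkt : kappa != 4 * tau ^+ 2)
    (E : ekt_space kappa tau) (S : surface E) (p : S)
    (a : chart R 2 S) (ha : satlas a) (hpa : cdom a p)
    (b : chart R 3 E) (hb : ekt_atlas b) (hpb : cdom b (simm p))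
    (e : 'I_2 -> 'rV[R]_2) :
  let X := locrep a b (@simm R kappa tau E S) in
  let N := fun u => snormal b (cinv a u) in
  let u := cmap a p in
  let g := first_form kappa tau X in
  let H := mean_curv kappa tau X N in
  let Ke := ext_curv kappa tau X N in
  let C := angle_fun kappa tau X N u in
  let T := xi_tan kappa tau X N u in
  let PhiT := endo (Phi kappa tau X N u) T in
  let JT := rotJ kappa tau X N u T in
  orthonormal_frame (g u) e ->
  cheng_yau kappa tau X N (fun v => 2 * H v) u =
    laplacian g Ke u + nablaA_sq kappa tau X N u e
    - 4 * grad_sq kappa tau X H u
    + Phi_sq kappa tau X N u *
      (2 * Ke u + (kappa - 4 * tau ^+ 2) * (5 * C ^+ 2 - 1) + 2 * tau ^+ 2)
    - 2 * (kappa - 4 * tau ^+ 2) *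
      (H u * gdot (g u) PhiT T + tau * gdot (g u) PhiT JT).
Proof.
move=> X N u g.
have oU := locdom_open ha hb.
have Uu : locdom a b (@simm R kappa tau E S) u by exists p.
have sX : smooth_mx (locdom a b (@simm R kappa tau E S)) X.
  by move=> i j; apply: (smooth_on_entry i j oU); exact: (simm_smooth S).2.
have sN : smooth_mx (locdom a b (@simm R kappa tau E S)) N.
  by move=> i j; apply: (smooth_on_entry i j oU); exact: snormal_smooth.
have X_dom v : locdom a b (@simm R kappa tau E S) v -> ekt_dom kappa (X v).
  move=> /(locdom_cinv ha) [av bv _]; apply: (ekt_cod hb).
  by exists (simm (cinv a v)).
have N_unit v : locdom a b (@simm R kappa tau E S) v ->
    gdot (amb kappa tau X v) (N v) (N v) = 1.
  by move=> /(locdom_cinv ha) [av bv _]; exact: (snormal_unit hb bv).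
have N_orth v : locdom a b (@simm R kappa tau E S) v ->
    forall i, gdot (amb kappa tau X v) (N v) (partial i X v) = 0.
  exact: (snormal_orthogonal ha hb).
have X_imm v : locdom a b (@simm R kappa tau E S) v -> \rank (jac X v) = 2%N.
  exact: (simm_immersion ha hb).
exact: (parametrized_formula oU sX sN X_dom N_unit N_orth X_imm Uu).
Qed.
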